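(* Let $p>1$, $\alpha_0\ge 0$, $\alpha_1\ge 0$, $\theta\ge 0$ be real numbers with $\alpha_1-p+1>0$, $\alpha_0\ge \alpha_1-p$ and $\theta>\alpha_1-p$, and put $p^*=\frac{(\theta+1)p}{\alpha_1-p+1}$. Let $\tau\ge1$ and $\beta>0$. Let $$L^{\beta}_{\theta,\ln}=\Big\{u:(0,1)\to\mathbb{R}\ \text{measurable}:\ \int_0^1 r^\theta|u(r)|^{p^*}\big|\ln(\tau+|u(r)|)\big|^{r^\beta}\,dr<\infty\Big\}$$ be endowed with the norm $$\|u\|_{L^\beta_{\theta,\ln}}=\inf\Big\{\lambda>0:\ \int_0^1 r^\theta\Big|\frac{u(r)}{\lambda}\Big|^{p^*}\Big|\ln\Big(\tau+\Big|\frac{u(r)}{\lambda}\Big|\Big)\Big|^{r^\beta}dr\le1\Big\}.$$ Then there is a continuous embedding $X^{1,p}_1(\alpha_0,\alpha_1)\hookrightarrow L^\beta_{\theta,\ln}$.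
   Context: For $\gamma\ge0$ and $q\ge1$, $L^q_\gamma=L^q_\gamma(0,1)$ is the Lebesgue space $L^q$ on $(0,1)$ with respect to the measure $r^\gamma dr$. $AC_{loc}(0,1)$ is the set of locally absolutely continuous functions on $(0,1)$. The weighted Sobolev space is $X^{1,p}_1(\alpha_0,\alpha_1)=\mathrm{cl}\{u\in AC_{loc}(0,1): \lim_{r\to1}u(r)=0,\ u\in L^p_{\alpha_0},\ u'\in L^p_{\alpha_1}\}$, the closure being with respect to the norm $(\|u\|^p_{L^p_{\alpha_0}}+\|u'\|^p_{L^p_{\alpha_1}})^{1/p}$. Under the stated assumptions this norm is equivalent to the gradient norm $\|u\|:=\|u'\|_{L^p_{\alpha_1}}=\big(\int_0^1 r^{\alpha_1}|u'|^p\,dr\big)^{1/p}$, and $X^{1,p}_1(\alpha_0,\alpha_1)$ is considered with this gradient norm. *)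

(* Defs.v *)
From HB Require Import structures.
From mathcomp Require Import all_boot all_order all_algebra.
From mathcomp Require Import all_classical all_reals all_analysis.
Set Implicit Arguments.
Unset Strict Implicit.
Unset Printing Implicit Defensive.
Import Order.TTheory GRing.Theory Num.Theory.
Import numFieldNormedType.Exports.
Local Open Scope classical_set_scope.
Local Open Scope ring_scope.

Section weighted_spaces.
Context {R : realType}.
Implicit Types (u v w du phi : R -> R) (p q alpha gamma : R).

Local Notation mu := (@lebesgue_measure R).
Local Notation unit_itv := (`]0%R, 1%R[%classic : set R).

Definition weighted_norm gamma q u : \bar R :=
  ((\int[mu]_(r in unit_itv) (r `^ gamma * `|u r| `^ q)%:E) `^ q^-1)%E.

Definition weighted_Lp gamma q u : Prop :=
  measurable_fun unit_itv u /\ (weighted_norm gamma q u < +oo)%E.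

Definition abs_continuous (a b : R) u : Prop :=
  forall e : R, 0 < e -> exists2 d : R, 0 < d &
    forall (n : nat) (B : 'I_n -> R * R),
      (forall i, a <= (B i).1 /\ (B i).1 <= (B i).2 /\ (B i).2 <= b) ->
      trivIset [set: 'I_n] (fun i => `](B i).1, (B i).2[%classic) ->
      \sum_(i < n) ((B i).2 - (B i).1) < d ->
      \sum_(i < n) `|u (B i).2 - u (B i).1| < e.

Definition AC_loc01 u : Prop :=
  forall a b : R, 0 < a -> a <= b -> b < 1 -> abs_continuous a b u.

(* A function in AC_loc01 is differentiable a.e. on ]0, 1[; derive1 u is its
   pointwise derivative, with a junk value on the null set where none exists. *)
Definition X1p_generator p (alpha0 alpha1 : R) u : Prop :=
  [/\ AC_loc01 u, u r @[r --> 1^'-] --> 0,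
      weighted_Lp alpha0 p u & weighted_Lp alpha1 p (derive1 u)].

Definition test_function01 phi : Prop :=
  (forall (n : nat) (x : R), derivable (derive1n n phi) x 1) /\
  exists a b : R, [/\ 0 < a, b < 1 &
    forall x : R, ~ (a <= x /\ x <= b) -> phi x = 0].

Definition locally_integrable01 u : Prop :=
  forall a b : R, 0 < a -> b < 1 -> mu.-integrable `[a, b] (EFin \o u).

Definition weak_derivative01 u du : Prop :=
  [/\ locally_integrable01 u, locally_integrable01 du &
    forall phi, test_function01 phi ->
      \int[mu]_(r in unit_itv) (u r * derive1 phi r) =
      - \int[mu]_(r in unit_itv) (du r * phi r)].

Definition sobolev_norm p (alpha0 alpha1 : R) u du : \bar R :=
  ((weighted_norm alpha0 p u `^ p + weighted_norm alpha1 p du `^ p) `^ p^-1)%E.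

(* "u belongs to X^{1,p}_1(alpha0, alpha1) and its derivative is du".  The
   closure is taken among all measurable functions u in L^p_{alpha0} having a
   weak derivative du in L^p_{alpha1}; du is determined by u up to a null set,
   and functions are represented pointwise rather than as a.e. classes. *)
Definition X1p p (alpha0 alpha1 : R) u du : Prop :=
  [/\ weighted_Lp alpha0 p u, weighted_Lp alpha1 p du,
      weak_derivative01 u du &
      forall e : R, 0 < e -> exists2 w, X1p_generator p alpha0 alpha1 w &
        (sobolev_norm p alpha0 alpha1 (u \- w)%R (du \- derive1 w)%R < e%:E)%E].

Definition gradient_norm p (alpha1 : R) du : \bar R := weighted_norm alpha1 p du.

Definition critical_exponent p (alpha1 theta : R) : R :=
  (theta + 1) * p / (alpha1 - p + 1).

(* The exponent s stands for the critical exponent p^*. *)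
Definition log_modular (theta s tau beta : R) u : \bar R :=
  (\int[mu]_(r in unit_itv)
    (r `^ theta * `|u r| `^ s * `|ln (tau + `|u r|)| `^ (r `^ beta))%:E)%E.

Definition L_ln (theta s tau beta : R) u : Prop :=
  measurable_fun unit_itv u /\ (log_modular theta s tau beta u < +oo)%E.

(* Extended-real infimum, so that it is +oo when no lambda is admissible. *)
Definition L_ln_norm (theta s tau beta : R) u : \bar R :=
  ereal_inf [set lambda%:E | lambda in
    [set lambda : R | 0 < lambda /\
      (log_modular theta s tau beta (fun r => u r / lambda)%R <= 1)%E]].

End weighted_spaces.

(* Main.v *)
(* Write g = |u'|, G(r) = int_r^1 g and N for the gradient norm of u.

   1. A locally absolutely continuous w vanishing at 1 satisfies
   |w(r)| <= int_r^1 |w'|: on [a, b], w is the difference of two nondecreasing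
   absolutely continuous functions (its total variation V and V - w), whose
   Lebesgue-Stieltjes measures are dominated by the Lebesgue measure, so that w
   is the primitive of a Radon-Nikodym density, which is w' almost everywhere by
   Lebesgue differentiation. By density, |u| <= G almost everywhere on (0, 1).

   2. For p - 1 < b < alpha1, Hoelder's inequality with weight s^b gives
   G(r)^p <= c r^(p-1-b) int_r^1 g^p s^b ds. Bounding s^b by r^(b-alpha1) s^alpha1
   yields |u(r)| <= c' N r^(-kappa) with kappa = (alpha1-p+1)/p, and Tonelli's
   theorem yields Hardy's inequality int r^(alpha1-p) G^p <= c'' N^p.

   3. Let s be the critical exponent, so that kappa s = theta + 1. Writing
   |u|^s = |u|^(s-p) |u|^p and using the pointwise bound on the first factor reduces
   int r^theta |u|^s to Hardy's inequality. The logarithmic factor is harmless: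
   ln(tau + |u(r)|) is at most A + kappa ln(1/r), and r^beta ln(A + kappa ln(1/r))
   is bounded on (0, 1). *)
Require Import Defs.
From HB Require Import structures.
From mathcomp Require Import all_boot all_order all_algebra finmap.
From mathcomp Require Import all_classical all_reals all_analysis.
From mathcomp Require Import ring lra measurable_realfun.
Import Order.TTheory GRing.Theory Num.Theory.
Import numFieldNormedType.Exports.
Local Open Scope classical_set_scope.
Local Open Scope ring_scope.

(** * Absolutely continuous functions *)

(* Indexing by an arbitrary finite type, instead of an ordinal, allows for dependent
   sums of partitions and for finite sets of intervals. *)
Definition abs_continuousT {R : realType} (F : R -> R) : Prop :=
  forall e : R, 0 < e -> exists2 d : R, 0 < d &
    forall (T : finType) (B : T -> R * R),
      (forall i, (B i).1 <= (B i).2) ->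
      trivIset [set: T] (fun i => `](B i).1, (B i).2[%classic) ->
      \sum_i ((B i).2 - (B i).1) < d ->
      \sum_i `|F (B i).2 - F (B i).1| <= e.

Section absolute_continuity.
Context {R : realType}.
Implicit Types (a b : R) (f F : R -> R).

Lemma abs_continuous_finType {a b f} {e : R} : abs_continuous a b f -> 0 < e ->
  exists2 d : R, 0 < d &
    forall (T : finType) (B : T -> R * R),
      (forall i, a <= (B i).1 /\ (B i).1 <= (B i).2 /\ (B i).2 <= b) ->
      trivIset [set: T] (fun i => `](B i).1, (B i).2[%classic) ->
      \sum_i ((B i).2 - (B i).1) < d ->
      \sum_i `|f (B i).2 - f (B i).1| < e.
Proof.
move=> acf e0; have [d d0 H] := acf _ e0; exists d => // T B Bab tB.
have reidx (h : T -> R) : \sum_i h i = \sum_(i < #|T|) h (enum_val i).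
  rewrite (reindex_onto enum_val enum_rank) => [|i _]; last exact: enum_rankK.
  by apply: eq_bigl => i; rewrite enum_valK eqxx.
rewrite (reidx (fun i => (B i).2 - _)) (reidx (fun i => `|_ - f (B i).1|)).
apply: (H _ (fun i => B (enum_val i))) => [i|]; first exact: Bab.
move=> i j _ _ ij; apply: enum_val_inj; exact: (tB (enum_val i) (enum_val j) I I ij).
Qed.

(** The default value [b] of [nth] is also the last point of the partition, so the sequence stays
    constant past its end and the order needs no bound on the indices. *)
Lemma itv_partition_nth_nondecreasing {a b} {s : seq R} : itv_partition a b s ->
  {homo nth b (a :: s) : m n / (m <= n)%N >-> m <= n}.
Proof.
move=> sP; apply: homo_leq => [x|y x z|k]; [exact: lexx|exact: le_trans|].
have [ks|sk] := ltnP k (size s).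
  exact: (nondecreasing_fun_itv_partition (f := id) _ sP).
rewrite [leRHS]nth_default//=; move: sk; rewrite leq_eqVlt => /orP[/eqP <-|sk].
  by rewrite (itv_partition_nth_size _ sP).
by rewrite nth_default.
Qed.

(** Passing from increments to variations is what makes the variation function itself absolutely
    continuous. The [d] of [f] serves unchanged; only the strict bound becomes weak, because of the
    suprema. *)
Lemma abs_continuous_total_variation {a b f} {e : R} : abs_continuous a b f -> 0 < e ->
  exists2 d : R, 0 < d &
    forall (T : finType) (B : T -> R * R),
      (forall i, a <= (B i).1 /\ (B i).1 <= (B i).2 /\ (B i).2 <= b) ->
      trivIset [set: T] (fun i => `](B i).1, (B i).2[%classic) ->
      \sum_i ((B i).2 - (B i).1) < d ->
      (\sum_i total_variation (B i).1 (B i).2 f <= e%:E)%E.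
Proof.
move=> acf e0; have [d d0 H] := abs_continuous_finType acf e0.
exists d => // T B Bab tB sB.
(* Concatenating one partition per interval gives a disjoint family, indexed by
   pairs (interval, step), of the same total length. *)
have H1 (s : T -> seq R) : (forall i, itv_partition (B i).1 (B i).2 (s i)) ->
    \sum_i variation (B i).1 (B i).2 f (s i) < e.
  move=> sP.
  pose p i := nth (B i).2 ((B i).1 :: s i).
  have p0 i : p i 0 = (B i).1 by [].
  have pS i : p i (size (s i)) = (B i).2 by exact: itv_partition_nth_size.
  pose C (k : {i : T & 'I_(size (s i))}) : R * R :=
    (p (tag k) (tagged k), p (tag k) (tagged k).+1).
  have sS (h : T -> nat -> R) :
      \sum_i \sum_(0 <= n < size (s i)) h i n =
      \sum_(k : {i : T & 'I_(size (s i))}) h (tag k) (tagged k).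
    under eq_bigr do rewrite big_mkord.
    by rewrite (sig_big_dep (fun=> true) (fun _ _ => true) (fun i (n : 'I__) => h i n)).
  have mono i : {homo p i : m n / (m <= n)%N >-> m <= n}.
    exact: itv_partition_nth_nondecreasing (sP i).
  rewrite /variation (sS (fun i n => `|f (p i n.+1) - f (p i n)|)).
  apply: (H _ C) => [[i n]|[i n] [j m] _ _|].
  - have [Ba [Bl Bb]] := Bab i.
    split => /=; first by rewrite (le_trans Ba)// -p0 mono.
    split; first exact: mono.
    by rewrite (le_trans _ Bb)// -pS mono// ltn_ord.
  - move=> /= [x []]; rewrite /= !in_itv/= => /andP[nx xn] /andP[mx xm].
    have eij : i = j.
      apply: tB => //; exists x; rewrite /= !in_itv/=; split; apply/andP; split.
      + by apply: le_lt_trans nx; rewrite -p0 mono.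
      + by apply: lt_le_trans xn _; rewrite -pS mono// ltn_ord.
      + by apply: le_lt_trans mx; rewrite -p0 mono.
      + by apply: lt_le_trans xm _; rewrite -pS mono// ltn_ord.
    subst j; congr existT; apply/val_inj/eqP => /=.
    rewrite eqn_leq; apply/andP; split; rewrite leqNgt; apply/negP => /(mono i).
      by move=> /(lt_le_trans xm)/lt_trans/(_ nx); rewrite ltxx.
    by move=> /(lt_le_trans xn)/lt_trans/(_ mx); rewrite ltxx.
  - rewrite -(sS (fun i n => p i n.+1 - p i n)).
    under eq_bigr do rewrite telescope_sumr//.
    by rewrite (eq_bigr (fun i => (B i).2 - (B i).1))// => i _; rewrite pS.
have part i : exists s, itv_partition (B i).1 (B i).2 s.
  have [_ [+ _]] := Bab i; rewrite le_eqVlt => /predU1P[->|Bl].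
    by exists [::]; split.
  by exists [:: (B i).2]; exact: itv_partition1.
(* [H1] bounds all intervals at once: interval [i] receives the arbitrary partition [s], the others
   a fixed one, whose nonnegative contribution is dropped. *)
have TVfin i : total_variation (B i).1 (B i).2 f \is a fin_num.
  have [_ [Bl _]] := Bab i; apply/(bounded_variationP _ Bl).
  have [s0 s0P] := choice part.
  exists e => _ [s sP <-].
  have := H1 (fun j => if pselect (j = i) is left ji then
    s else s0 j).
  have sel : forall j, itv_partition (B j).1 (B j).2
       (if pselect (j = i) is left _ then s else s0 j).
    by move=> j; case: pselect => // ->.
  move=> /(_ sel); rewrite (bigD1 i)//=; case: pselect => // _ /ltW; apply: le_trans.
  by rewrite lerDl sumr_ge0// => j _; exact: variation_ge0.
apply/lee_addgt0Pr => e' e'0.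
(* The error [e'] is shared among the intervals; dividing by the successor of the cardinal also
   covers an empty [T]. *)
have n0 : 0 < #|T|.+1%:R :> R by [].
have ap i : exists s, itv_partition (B i).1 (B i).2 s /\
   (total_variation (B i).1 (B i).2 f <= (variation (B i).1 (B i).2 f s + e' / #|T|.+1%:R)%:E)%E.
  have [_ [_ [s sP <-] <-] /ltW] := ub_ereal_sup_adherent (divr_gt0 e'0 n0) (TVfin i).
  by rewrite leeBlDr// -EFinD => leTV; exists s.
have [s sP] := choice ap.
apply: (@le_trans _ _ (\sum_i (variation (B i).1 (B i).2 f (s i) + e' / #|T|.+1%:R)%:E)%E).
  by apply: lee_sum => i _; have [] := sP i.
rewrite sumEFin lee_fin big_split/= sumr_const.
apply: lerD; first by apply/ltW/H1 => i; have [] := sP i.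
rewrite -(mulr_natr (_ / _)) mulrAC ler_pdivrMr//.
by apply: ler_wpM2l; rewrite ?ler_nat// ltW.
Qed.

(** The variation is at most 1 on any interval shorter than the [d] attached to 1, and finitely many
    such intervals cover the whole. *)
Lemma abs_continuous_bounded_variation a b f : a <= b ->
  abs_continuous a b f -> bounded_variation a b f.
Proof.
move=> ab acf; have [d d0 H] := abs_continuous_total_variation acf ltr01.
have small x y : a <= x -> x <= y -> y <= b -> y - x < d ->
    total_variation x y f \is a fin_num.
  move=> ax xy yb xyd; rewrite ge0_fin_numE ?total_variation_ge0//.
  have := H unit (fun=> (x, y)); rewrite !big_const card_unit/= adde0 addr0.
  by move=> /(_ (fun=> conj ax (conj xy yb)) _ xyd)/le_lt_trans ->; rewrite ?ltry// => -[] [].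
(* Steps of length [d / 2] keep the lengths strictly below [d]. The induction on their number peels
   them off from the left, the right end staying at [b]. *)
have [n nd] : exists n : nat, b - a <= n%:R * (d / 2).
  exists (Num.truncn ((b - a) / (d / 2))).+1.
  by rewrite -ler_pdivrMr ?divr_gt0// ltW// truncnS_gt.
apply/(bounded_variationP _ ab).
suff H1 (x : R) : b - x <= n%:R * (d / 2) -> a <= x -> x <= b ->
    total_variation x b f \is a fin_num by exact: H1.
elim: n {nd} x => [|n ih] x + ax xb => [nd|].
  by rewrite mul0r in nd; apply: small => //; exact: le_lt_trans d0.
rewrite -natr1 mulrDl mul1r => nd.
have [dxb|xbd] := leP d (b - x); last exact: small.
have xd : x <= x + d / 2 by lra.
have db : x + d / 2 <= b by lra.
rewrite (total_variationD f xd db).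
by rewrite fin_numD; apply/andP; split; [apply: small|apply: ih]; lra.
Qed.

(** Jordan decomposition: [F] is the variation function of [f] and [G] is [F - f]. Both must live on
    the whole line to be distribution functions of Lebesgue-Stieltjes measures. *)
Lemma abs_continuous_nondecreasing_decomposition {a b f} : a <= b ->
    abs_continuous a b f ->
  exists F G : R -> R, [/\ nondecreasing F /\ abs_continuousT F,
    nondecreasing G /\ abs_continuousT G &
    forall x, a <= x -> x <= b -> f x = F x - G x].
Proof.
move=> ab acf.
have BVf := abs_continuous_bounded_variation _ _ _ ab acf.
have TVfin x y : a <= x -> x <= y -> y <= b -> total_variation x y f \is a fin_num.
  move=> ax xy yb; apply/(bounded_variationP _ xy).
  exact/(bounded_variationl xy yb)/(bounded_variationr ax (le_trans xy yb)).
(* Clamping to [[a, b]] extends functions by constants. It is monotone, does not lengthen intervals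
   ([cd]), and an interior point of a clamped interval lies inside the original one ([cin]), so
   disjointness survives. *)
pose c x : R := Num.max a (Num.min b x).
have ca x : a <= c x by rewrite le_max lexx.
have cb x : c x <= b by rewrite ge_max ab ge_min lexx.
have cle x y : x <= y -> c x <= c y.
  by move=> xy; exact/le_max2/le_min2.
have cE x : a <= x -> x <= b -> c x = x.
  by move=> ax xb; rewrite /c (min_idPr xb) (max_idPr ax).
have cin x y z : x <= y -> c x < z -> z < c y -> x < z /\ z < y.
  move=> xy; rewrite /c gt_max gt_min !lt_max !lt_min => /andP[az xz] /orP[za|/andP[bz yz]].
    by have := lt_trans az za; rewrite ltxx.
  split => //; case/orP: xz => // /lt_trans /(_ bz); by rewrite ltxx.
have cd x y : x <= y -> c y - c x <= y - x.
  move=> xy; rewrite lerBlDr {1}/c ge_max ge_min; apply/andP; split.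
    by have := ca x; lra.
  have [bx|/ltW xb] := leP b x.
    by have : b <= c x; [rewrite le_max le_min lexx bx orbT|lra].
  by have : x <= c x; [rewrite le_max le_min lexx xb orbT|lra].
pose V x := fine (total_variation a (c x) f).
have VE x y : x <= y -> V y - V x = fine (total_variation (c x) (c y) f).
  move=> xy; rewrite /V (total_variationD f (ca x) (cle _ _ xy)).
  by rewrite fineD ?TVfin ?lexx ?cle ?ca ?cb// addrAC subrr add0r.
have Vf x y : x <= y -> `|f (c y) - f (c x)| <= V y - V x.
  move=> xy; rewrite VE// -lee_fin fineK; last by apply: TVfin => //; exact: cle.
  exact/total_variation_ge/cle.
have acV : abs_continuousT V.
  move=> e e0; have [d d0 H] := abs_continuous_total_variation acf e0.
  exists d => // T B B12 tB sB.
  rewrite (eq_bigr (fun i => fine (total_variation (c (B i).1) (c (B i).2) f))) => [|i _]; last first.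
    by rewrite ger0_norm -?VE// (le_trans _ (Vf _ _ (B12 i))).
  rewrite -lee_fin -sumEFin.
  rewrite (eq_bigr (fun i => total_variation (c (B i).1) (c (B i).2) f)) => [|i _]; last first.
    by rewrite fineK// TVfin// cle.
  apply: (H T (fun i => (c (B i).1, c (B i).2))) => [i||] /=.
  - by split=> //; split=> //; exact: cle.
  - move=> i j _ _ [x []]; rewrite /= !in_itv/= => /andP[ix xi] /andP[jx xj].
    apply: tB => //; exists x; rewrite /= !in_itv/=.
    by have [-> ->] := cin _ _ _ (B12 i) ix xi; have [-> ->] := cin _ _ _ (B12 j) jx xj.
  - by apply: le_lt_trans sB; apply: ler_sum => i _; exact: cd.
have ndV : nondecreasing V.
  by move=> x y xy; rewrite -subr_ge0 (le_trans _ (Vf _ _ xy)).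
(* An increment of [f] is at most that of [V], so [V - f] varies at most twice as much as [V] and
   inherits absolute continuity, with [e / 2] in place of [e]. *)
have acE x y : x <= y -> `|(V y - f (c y)) - (V x - f (c x))| <= 2 * `|V y - V x|.
  move=> xy; have := Vf _ _ xy; rewrite (ger0_norm (_ : 0 <= V y - V x)) ?subr_ge0 ?ndV//.
  rewrite !ler_norml; lra.
exists V, (fun x => V x - f (c x)); split.
- by [].
- split.
    by move=> x y xy; have := Vf _ _ xy; rewrite ler_norml; lra.
  move=> e e0; have e20 : 0 < e / 2 by rewrite divr_gt0.
  have [d d0 H] := acV _ e20.
  exists d => // T B B12 tB sB.
  apply: (@le_trans _ _ (\sum_i 2 * `|V (B i).2 - V (B i).1|)).
    by apply: ler_sum => i _; exact: acE.
  by rewrite -mulr_sumr mulrC -ler_pdivlMr// H.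
- by move=> x ax xb; rewrite cE//; lra.
Qed.
End absolute_continuity.

(** * Lebesgue-Stieltjes measures of absolutely continuous functions *)

Section lebesgue_stieltjes_abs_continuous.
Context {R : realType}.
Local Open Scope measure_display_scope.
Local Notation mu := (@lebesgue_measure R).

Lemma lebesgue_stieltjes_measure_itvoc (F : cumulative R R) (x y : R) : x <= y ->
  lebesgue_stieltjes_measure F `]x, y] = (F y - F x)%:E.
Proof.
move=> xy; rewrite /lebesgue_stieltjes_measure/= /measure_extension.
by rewrite measurable_mu_extE/= ?wlength_itv_bnd//; exact: is_ocitv.
Qed.

(** The covers that define the outer measure may overlap, whereas absolute continuity speaks of
    disjoint families. A finite union of half-open intervals belongs to the ring they generate, and
    a set of that ring is a finite disjoint union of such intervals. *)
Lemma bigsetU_ocitv_decomposition (C : nat -> set (ocitv_type R)) n :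
  (forall k, measurable (C k)) -> exists (T : finType) (B : T -> R * R),
  [/\ forall i, (B i).1 <= (B i).2,
      trivIset [set: T] (fun i => `](B i).1, (B i).2]%classic) &
      \big[setU/set0]_(k < n) C k = \bigcup_i `](B i).1, (B i).2]%classic ].
Proof.
move=> mC.
have mU : measurable (\big[setU/set0]_(k < n) C k : set (SetRing.type (ocitv_type R))).
  by apply: bigsetU_measurable => k _; exact: SetRing.measurable_subring.
have [D [finD D0 tD mD ->]] := SetRing.ring_finite_set mU.
have H (X : set R) : exists xy : R * R, D X -> xy.1 <= xy.2 /\ X = `]xy.1, xy.2]%classic.
  have [DX|nDX] := pselect (D X); last by exists (0, 0).
  have /ocitvP[X0|[xy xy12 ->]] := mD _ (mem_set DX).
    by have := D0 _ DX; rewrite X0 => /set0P; rewrite eqxx.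
  by exists xy; split => //; exact: ltW.
have [h hP] := choice H.
exists (fset_set D : finType), (fun X => h (val X)).
have DP (i : fset_set D) : D (val i).
  by have := fsvalP i; rewrite in_fset_set// => /set_mem.
split.
- by move=> i; have [] := hP _ (DP i).
- move=> i j _ _.
  have [_ <-] := hP _ (DP i); have [_ <-] := hP _ (DP j) => ij.
  by apply: val_inj; exact: (tD _ _ (DP i) (DP j) ij).
- apply/seteqP; split=> [x [X DX Xx]|x [i _]].
    have XD : X \in fset_set D by rewrite in_fset_set//; exact: mem_set.
    exists [` XD]%fset => //=.
    have [_ E] := hP _ DX.
    by have : (`](h X).1, (h X).2]%classic : set R) x by rewrite -E.
  by have [_ <-] := hP _ (DP i) => ix; exists (val i).
Qed.

(** A null set has a cover by half-open intervals of total length below [d]. Each finite part of it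
    is a disjoint union of total length below [d], hence has [F]-measure at most [e]; continuity
    from below extends this to the whole cover. *)
Lemma lebesgue_stieltjes_measure_dominates (F : cumulative R R) :
  abs_continuousT F -> lebesgue_stieltjes_measure F `<< mu.
Proof.
move=> acF.
have H (A : set R) : measurable A -> mu A = 0%E -> lebesgue_stieltjes_measure F A = 0%E.
  move=> mA A0; apply/eqP; rewrite eq_le measure_ge0 andbT.
  apply/lee_addgt0Pr => e e0; rewrite add0e.
  have [d d0 Hd] := acF _ e0.
  have mu0 : (mu_ext (wlength idfun) A < d%:E)%E.
    move: A0; rewrite /lebesgue_measure /lebesgue_stieltjes_measure /=.
    by rewrite /measure_extension => ->; rewrite lte_fin.
  have [_ [C [mC AC] <-] Cd] := ereal_inf_lt mu0.
  have mCR k : measurable (C k : set R) by apply: sub_sigma_algebra; exact: mC.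
  apply: (@le_trans _ _ (lebesgue_stieltjes_measure F (\bigcup_k C k))).
    by apply: le_measure => //; apply: mem_set => //; apply: bigcup_measurable => k _; exact: mCR.
  have cvg : lebesgue_stieltjes_measure F (\big[setU/set0]_(k < n) C k) @[n --> \oo] -->
      lebesgue_stieltjes_measure F (\bigcup_k C k).
    have UE : \bigcup_k C k = \bigcup_n \big[setU/set0]_(k < n) C k.
      apply/seteqP; split=> [x [k _ Ckx]|x [n _]].
        by exists k.+1 => //; rewrite -bigcup_mkord; exists k => /=.
      by rewrite -bigcup_mkord => -[k _ Ckx]; exists k.
    rewrite UE; apply: nondecreasing_cvg_mu => [n||].
    - by apply: bigsetU_measurable => k _; exact: mCR.
    - by rewrite -UE; apply: bigcup_measurable => k _; exact: mCR.
    - by move=> m n mn; apply/subsetPset/subset_bigsetU.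
  rewrite -(cvg_lim _ cvg)//; apply: lime_le; first by apply/cvg_ex; eexists; exact: cvg.
  apply: nearW => n.
  have [T [B [B12 tB UB]]] := bigsetU_ocitv_decomposition C n mC.
  rewrite UB.
  (* Stated for any [G] because it serves twice: for [F], to express the measure to be bounded, and
     for the identity, to express the total length. *)
  have BE (G : cumulative R R) :
      lebesgue_stieltjes_measure G (\bigcup_i `](B i).1, (B i).2]%classic) =
      (\sum_i (G (B i).2 - G (B i).1))%:E.
    have finT : finite_set [set: T].
      have := finite_finpred (pred_of_argType T).
      by congr finite_set; apply/seteqP; split.
    rewrite measure_fin_bigcup//.
    rewrite fsbig_finite// -sumEFin.
    have pe : perm_eq (fset_set [set: T]) (index_enum T).
      apply: uniq_perm => [||i]; [exact: fset_uniq|exact: index_enum_uniq|].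
      by rewrite mem_index_enum in_fset_set// in_setT.
    rewrite (perm_big _ pe)/=.
    apply: eq_bigr => i _; exact: lebesgue_stieltjes_measure_itvoc.
  rewrite BE lee_fin (eq_bigr (fun i => `|F (B i).2 - F (B i).1|)) => [|i _]; last first.
    by rewrite ger0_norm// subr_ge0 cumulative_is_nondecreasing.
  apply: Hd => //.
    move=> i j _ _ [x []]; rewrite /= !in_itv/= => /andP[? /ltW ?] /andP[? /ltW ?].
    by apply: tB => //; exists x; rewrite /= !in_itv/=; split; apply/andP.
  rewrite -lte_fin.
  have := BE idfun => /= <-; rewrite -UB.
  apply: le_lt_trans Cd.
  rewrite (eq_eseriesr (g := fun k => lebesgue_stieltjes_measure idfun (C k))) =>
    [|k _]; last first.
    by rewrite /lebesgue_stieltjes_measure/= /measure_extension measurable_mu_extE.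
  apply: measure_sigma_subadditive => //.
    by apply: bigsetU_measurable => k _; exact: mCR.
  by move=> x; rewrite -bigcup_mkord => -[k _ Ckx]; exists k.
apply/null_content_dominatesP => A mA A0; exact: H.
Qed.
End lebesgue_stieltjes_abs_continuous.

(** * Absolutely continuous functions as primitives *)

Section fundamental_theorem.
Context {R : realType}.
Implicit Types (a b : R) (f F : R -> R).
Local Notation mu := (@lebesgue_measure R).

Lemma abs_continuousT_density {F} a b : a <= b -> nondecreasing F -> abs_continuousT F ->
  exists g : R -> R, mu.-integrable [set: R] (EFin \o g) /\
    forall y, a <= y -> y <= b -> (F y - F a)%:E = (\int[mu]_(t in `]a, y]) (g t)%:E)%E.
Proof.
move=> ab ndF acF.
have rcF : right_continuous F.
  move=> x; apply/cvgrPdist_le => e e0.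
  have [d d0 Hd] := acF _ e0.
  near=> y.
  have xy : x <= y by [].
  have := Hd unit (fun=> (x, y)); rewrite !big_const card_unit/= !addr0 distrC.
  by apply => //; [case; case|rewrite ltrBlDl; near: y; apply: nbhs_right_lt; lra].
pose F' : cumulative R R := HB.pack_for (cumulative R R) F (isCumulative.Build R _ R F ndF rcF).
pose nu : {measure set (measurableTypeR R) -> \bar R} := lebesgue_stieltjes_measure F'.
have nuE x y : x <= y -> nu `]x, y]%classic = (F y - F x)%:E.
  exact: lebesgue_stieltjes_measure_itvoc.
have Doo : (nu `]a, b]%classic < +oo)%E by rewrite nuE// ltry.
have mD : measurable (`]a, b]%classic : set (measurableTypeR R)) by exact: measurable_itv.
(* Restricting to []a, b]] makes the measure finite, so that its Radon-Nikodym density is integrable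
   on the whole line. *)
pose nuD : {finite_measure set (measurableTypeR R) -> \bar R} := mfrestr mD Doo.
have dom : nuD `<< mu.
  apply/null_content_dominatesP => A mA A0.
  apply/eqP; rewrite eq_le measure_ge0 andbT /nuD/= /mfrestr/= /mrestr.
  have /null_content_dominatesP/(_ A mA A0) <- := lebesgue_stieltjes_measure_dominates F' acF.
  by apply: le_measure => //; apply: mem_set => //; exact: measurableI.
have [h [h0 hfin ih hE]] := radon_nikodym_sigma_finite dom.
exists (fine \o h); split.
  by apply: eq_integrable ih => // x _; rewrite /= fineK.
move=> y ay yb; rewrite -nuE//.
under eq_integral do rewrite fineK//.
rewrite -hE// /nuD/= /mfrestr/= /mrestr; by rewrite setIidl//; exact: subset_itvl.
Unshelve. all: by end_near. Qed.

Lemma abs_continuous_primitive {a b f} : a <= b -> abs_continuous a b f ->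
  exists g : R -> R, mu.-integrable [set: R] (EFin \o g) /\
    forall y, a <= y -> y <= b -> f y - f a = \int[mu]_(t in `]a, y]) g t.
Proof.
move=> ab acf.
have [F [G [[ndF acF] [ndG acG] fE]]] := abs_continuous_nondecreasing_decomposition ab acf.
have [g1 [ig1 g1E]] := abs_continuousT_density a b ab ndF acF.
have [g2 [ig2 g2E]] := abs_continuousT_density a b ab ndG acG.
exists (g1 \- g2); split; first exact: (integrableB _ ig1 ig2).
move=> y ay yb; rewrite !fE//.
have ig1' : mu.-integrable `]a, y] (EFin \o g1) by exact: integrableS ig1.
have ig2' : mu.-integrable `]a, y] (EFin \o g2) by exact: integrableS ig2.
rewrite RintegralB// /Rintegral -g1E// -g2E//=; lra.
Qed.

(** By Lebesgue differentiation the density [g] of [f] equals [derive1 f] almost everywhere, so the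
    claim is the triangle inequality for the integral of [g]. *)
Lemma abs_continuous_le_integral_derive1 a b f : a <= b -> abs_continuous a b f ->
  measurable_fun `]a, b[ (derive1 f) ->
  (`|f b - f a|%:E <= \int[mu]_(t in `]a, b[) `|derive1 f t|%:E)%E.
Proof.
move=> ab acf mf.
have [g [ig gE]] := abs_continuous_primitive ab acf.
have ig1 y : mu.-integrable [set` Interval (BRight a) (BRight y)] (EFin \o g).
  by apply: integrableS ig.
have lg : locally_integrable [set: R] g by exact: open_integrable_locally openT _.
have := FTC1 ig1 lg.
move=> /= der.
have aeq : {ae mu, forall x, x \in `]a, b[ -> derive1 f x = g x}.
  move: der; apply: filterS; first exact: (ae_filter_ringOfSetsType mu).
  move=> x /= H; rewrite in_itv/= => /andP[ax xb].
  have [dPhi <-] := H ax.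
  (* Around an interior point, [f] coincides with [f a] plus the primitive of [g], so both have the
     same derivative there. *)
  rewrite !derive1E (@near_eq_derive _ _ _ _ (cst (f a) \+ (fun y => \int[mu]_(t in `]a, y]) g t))).
    by rewrite deriveD//= derive_cst add0r.
  near=> y; rewrite /= -gE//; first by rewrite addrC subrK.
    by apply/ltW; near: y; exact: lt_nbhsr.
  by apply/ltW; near: y; exact: lt_nbhsl.
have ig' : mu.-integrable `]a, b[ (EFin \o g) by exact: integrableS ig.
have mg : measurable_fun `]a, b[ g by apply/measurable_EFinP; exact: measurable_int ig'.
have -> : (\int[mu]_(t in `]a, b[) `|derive1 f t|%:E = \int[mu]_(t in `]a, b[) `|g t|%:E)%E.
  apply: ge0_ae_eq_integral => //.
  - exact/measurable_EFinP/measurableT_comp.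
  - exact/measurable_EFinP/measurableT_comp.
  - move: aeq; apply: filterS; first exact: (ae_filter_ringOfSetsType mu).
    by move=> x /= H /H ->.
rewrite gE//.
rewrite integral_itv_bndo_bndc; last exact/measurable_EFinP/measurableT_comp.
have igab : mu.-integrable `]a, b] (EFin \o g) by exact: integrableS ig.
rewrite EFin_normr_Rintegral//.
apply: le_abse_integral => //.
by apply: measurable_int igab.
Unshelve. all: by end_near. Qed.
End fundamental_theorem.

(** * Weighted Hoelder and Hardy inequalities *)

Section power_integrals.
Context {R : realType}.
Local Notation mu := (@lebesgue_measure R).

Lemma powR_continuous_gt0 (e x : R) : 0 < x -> {for x, continuous (fun t : R => t `^ e)}.
Proof.
move=> x0; apply/differentiable_continuous/derivable1_diffP.
by apply: derivable_powR; rewrite in_itv/= x0.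
Qed.

Lemma integral_powR_itvcc (e x y : R) : e + 1 != 0 -> 0 < x -> x < y ->
  (\int[mu]_(t in `[x, y]) (t `^ e)%:E = ((y `^ (e + 1) - x `^ (e + 1)) / (e + 1))%:E)%E.
Proof.
move=> e1 x0 xy.
have pos t : x <= t -> 0 < t by exact: lt_le_trans.
have cF t : 0 < t -> {for t, continuous (fun t => (e + 1)^-1 * t `^ (e + 1))}.
  by move=> t0; apply: cvgM; [exact: cvg_cst|exact: powR_continuous_gt0].
rewrite (@continuous_FTC2 _ _ (fun t => (e + 1)^-1 * t `^ (e + 1)))//.
- by rewrite -EFinB -mulrBr mulrC.
- apply: continuous_in_subspaceT => t; rewrite inE/= in_itv/= => /andP[xt _].
  exact/powR_continuous_gt0/pos.
- split.
  + move=> t; rewrite in_itv/= => /andP[/ltW xt _].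
    by apply: derivableM => //; apply: derivable_powR; rewrite in_itv/= pos.
  + exact/cvg_at_right_filter/cF.
  + by apply/cvg_at_left_filter/cF/pos/ltW.
- move=> t; rewrite in_itv/= => /andP[/ltW xt _].
  have tp : t \in `]0, +oo[ by rewrite in_itv/= pos.
  rewrite derive1E deriveM//; last exact: derivable_powR.
  rewrite derive_cst scaler0 addr0 -derive1E powR_derive1//.
  by rewrite addrK /GRing.scale/= mulrA mulVf// mul1r.
Qed.

Lemma measurable_powRT (e : R) (D : set R) : measurable_fun D (fun t : R => t `^ e).
Proof. by apply: measurable_funTS; exact: measurable_powR. Qed.

Lemma integral_powRN_le (c r : R) : 1 < c -> 0 < r -> r < 1 ->
  (\int[mu]_(t in `]r, 1%R[) (t `^ (- c))%:E <= (r `^ (1 - c) / (c - 1))%:E)%E.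
Proof.
move=> c1 r0 r1.
have mp D : measurable_fun D (fun t : R => (t `^ (- c))%:E).
  by apply/measurable_EFinP; exact: measurable_powRT.
apply: (@le_trans _ _ (\int[mu]_(t in `[r, 1%R]) (t `^ (- c))%:E)%E).
  apply: ge0_subset_integral => //.
  - exact: mp.
  - by move=> t _; rewrite lee_fin powR_ge0.
  - exact: subset_itv_oo_cc.
rewrite integral_powR_itvcc//; last by rewrite lt_eqF//; lra.
rewrite lee_fin powR1 (addrC (- c)) -mulrNN -invrN !opprB.
by rewrite ler_pM2r ?invr_gt0 ?subr_gt0// lerBlDr lerDl.
Qed.

Lemma integral_powR_le (d s : R) : 0 < d -> 0 < s ->
  (\int[mu]_(t in `]0%R, s[) (t `^ (d - 1))%:E <= (s `^ d / d)%:E)%E.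
Proof.
move=> d0 s0.
have mp D : measurable_fun D (fun t : R => (t `^ (d - 1))%:E).
  by apply/measurable_EFinP; exact: measurable_powRT.
(* The integrand may be singular at 0, so []0, s[] is exhausted by compact intervals and monotone
   convergence applies. With [i.+2] the left end is strictly below [s] even for [i = 0]. *)
pose F (i : nat) : set R := `[s / i.+2%:R, s]%classic.
have FU : `]0, s[ `<=` \bigcup_i F i.
  move=> t /=; rewrite in_itv/= => /andP[t0 ts].
  have st0 : 0 < s / t by rewrite divr_gt0.
  exists (Num.truncn (s / t)) => //=; rewrite /F/= in_itv/= (ltW ts) andbT.
  rewrite ler_pdivrMr// mulrC -ler_pdivrMr//.
  by rewrite ltW// (lt_trans (truncnS_gt _))// ltr_nat.
apply: (@le_trans _ _ (\int[mu]_(t in \bigcup_i F i) (t `^ (d - 1))%:E)%E).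
  apply: ge0_subset_integral => //.
  - by apply: bigcup_measurable => k _; exact: measurable_itv.
  - exact: mp.
  - by move=> t _; rewrite lee_fin powR_ge0.
have cvF : (\int[mu]_(t in F i) (t `^ (d - 1))%:E)%E @[i --> \oo] -->
    (\int[mu]_(t in \bigcup_i F i) (t `^ (d - 1))%:E)%E.
  apply: ge0_nondecreasing_set_cvg_integral => //.
  - move=> i j ij; apply/subsetPset => t; rewrite /F/= !in_itv/= => /andP[it ->].
    rewrite andbT (le_trans _ it)// ler_wpM2l ?(ltW s0)//.
    by rewrite lef_pV2 ?posrE// ler_nat.
  - by move=> i; exact: measurable_itv.
  - by move=> i; exact: mp.
  - by move=> i t _; rewrite lee_fin powR_ge0.
rewrite -(cvg_lim _ cvF)//; apply: lime_le; first exact: cvgP cvF.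
apply: nearW => i; rewrite /F integral_powR_itvcc.
- by rewrite subrK lee_fin ler_pM2r ?invr_gt0// lerBlDr lerDl powR_ge0.
- by rewrite subrK gt_eqF.
- by rewrite divr_gt0.
- by rewrite ltr_pdivrMr// ltr_pMr// ltr1n.
Qed.

End power_integrals.

Section weighted_hoelder.
Context {R : realType}.
Local Notation mu := (@lebesgue_measure R).

(** Hoelder's inequality on the line, applied to the extensions by zero. The exponents are nonzero,
    so the extensions contribute nothing outside [D]. *)
Lemma hoelder_set (D : set R) (f h : R -> R) (p q : R) : measurable D ->
  measurable_fun D f -> measurable_fun D h ->
  0 < p -> 0 < q -> p^-1 + q^-1 = 1 ->
  (\int[mu]_(x in D) `|f x * h x|%:E <=
   ((\int[mu]_(x in D) (`|f x| `^ p)%:E) `^ p^-1) *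
   ((\int[mu]_(x in D) (`|h x| `^ q)%:E) `^ q^-1))%E.
Proof.
move=> mD mf mh p0 q0 pq.
have mf' : measurable_fun [set: R] (f \_ D) by apply/(measurable_restrictT f mD).
have mh' : measurable_fun [set: R] (h \_ D) by apply/(measurable_restrictT h mD).
have := hoelder mu mf' mh' p0 q0 pq.
rewrite Lnorm1 unlock /=.
have E (k : R -> R) (e : R) : e != 0 ->
    (\int[mu]_x (`|(k \_ D) x| `^ e)%:E = \int[mu]_(x in D) (`|k x| `^ e)%:E)%E.
  move=> e0; rewrite [RHS]integral_mkcond; apply: eq_integral => x _.
  by rewrite !patchE; case: ifPn => // _; rewrite normr0 powR0.
rewrite !E ?gt_eqF//; congr (_ <= _)%E.
rewrite [RHS]integral_mkcond; apply: eq_integral => x _.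
by rewrite !patchE; case: ifPn => // _; rewrite mul0r normr0.
Qed.

Lemma ge0_lee_poweR {x y : \bar R} {e : R} : 0 <= e -> (0 <= x)%E -> (x <= y)%E ->
  (x `^ e <= y `^ e)%E.
Proof.
move=> e0 x0 xy; have y0 := le_trans x0 xy.
by apply: gt0_ler_poweR => //; rewrite in_itv/= ?x0 ?y0 leey.
Qed.

Lemma integral_itv_weighted_hoelder (g : R -> R) (p b r : R) : 1 < p -> p - 1 < b ->
  measurable_fun (`]0, 1[%classic : set R) g -> 0 < r -> r < 1 ->
  ((\int[mu]_(s in `]r, 1%R[) `|g s|%:E) `^ p <=
   (((p - 1) / (b - p + 1)) `^ (p - 1) * r `^ (p - 1 - b))%:E *
   \int[mu]_(s in `]r, 1%R[) (`|g s| `^ p * s `^ b)%:E)%E.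
Proof.
move=> p1 bp mg r0 r1.
have p0 : 0 < p by lra.
pose q := p / (p - 1).
have p10 : 0 < p - 1 by lra.
have q0 : 0 < q by rewrite divr_gt0.
have pq : p^-1 + q^-1 = 1 by rewrite /q; field; rewrite ?gt_eqF.
have D01 : `]r, 1[ `<=` (`]0, 1[ : set R).
  by move=> s /=; rewrite !in_itv/= => /andP[rs ->]; rewrite (lt_trans r0).
have mD : measurable (`]r, 1[%classic : set R) by [].
have mgr : measurable_fun `]r, 1[ g by exact: measurable_funS mg.
have mpow e : measurable_fun `]r, 1[ (fun s : R => s `^ e) by exact: measurable_powRT.
have := @hoelder_set _ (fun s => g s * s `^ (b / p)) (fun s => s `^ (- (b / p))) p q mD
  (measurable_funM mgr (mpow _)) (mpow _) p0 q0 pq.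
have pos s : s \in `]r, 1[ -> 0 < s by rewrite in_itv/= => /andP[/(lt_trans r0)].
have -> : (\int[mu]_(x in `]r, 1%R[) `|g x * x `^ (b / p) * x `^ (- (b / p))|%:E =
    \int[mu]_(x in `]r, 1%R[) `|g x|%:E)%E.
  apply: eq_integral => s; rewrite inE/= => /pos s0.
  by rewrite powRN mulfK// gt_eqF// powR_gt0.
have -> : (\int[mu]_(x in `]r, 1%R[) (`|g x * x `^ (b / p)| `^ p)%:E =
    \int[mu]_(x in `]r, 1%R[) (`|g x| `^ p * x `^ b)%:E)%E.
  apply: eq_integral => s; rewrite inE/= => /pos s0.
  by rewrite normrM powRM// (ger0_norm (powR_ge0 _ _)) -powRrM divfK// gt_eqF.
have bc : 1 < b / (p - 1) by rewrite ltr_pdivlMr// mul1r.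
have le2 : (\int[mu]_(x in `]r, 1%R[) (`|x `^ (- (b / p))| `^ q)%:E <=
    (r `^ (1 - b / (p - 1)) / (b / (p - 1) - 1))%:E)%E.
  have -> : (\int[mu]_(x in `]r, 1%R[) (`|x `^ (- (b / p))| `^ q)%:E =
      \int[mu]_(x in `]r, 1%R[) (x `^ (- (b / (p - 1))))%:E)%E.
    apply: eq_integral => s; rewrite inE/= => /pos s0.
    rewrite (ger0_norm (powR_ge0 _ _)) -powRrM; congr (_ `^ _)%:E.
    by rewrite /q; field; rewrite !gt_eqF.
  exact: integral_powRN_le.
set I := (\int[mu]_(s in _) _)%E; set J := (\int[mu]_(s in _) _)%E.
set K := (\int[mu]_(s in _) _)%E.
have J0 : (0 <= J)%E by apply: integral_ge0 => s _; rewrite lee_fin mulr_ge0// powR_ge0.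
have I0 : (0 <= I)%E by apply: integral_ge0 => s _; rewrite lee_fin.
have K0 : (0 <= K)%E by apply: integral_ge0 => s _; rewrite lee_fin powR_ge0.
move=> /(ge0_lee_poweR (ltW p0) I0) H; apply: (le_trans H).
rewrite poweRM ?poweR_ge0// -!poweRrM mulVf ?gt_eqF// poweRe1// muleC.
apply: lee_wpmul2r => //.
have -> : q^-1 * p = p - 1 by rewrite /q; field; rewrite !gt_eqF.
apply: (@le_trans _ _ (((r `^ (1 - b / (p - 1)) / (b / (p - 1) - 1))%:E) `^ (p - 1))%E).
  exact: ge0_lee_poweR (ltW p10) K0 le2.
rewrite poweR_EFin lee_fin powRM ?powR_ge0// ?invr_ge0 ?subr_ge0 ?(ltW bc)//.
rewrite -powRrM mulrC.
have -> : (b / (p - 1) - 1)^-1 = (p - 1) / (b - p + 1).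
  by field; rewrite !gt_eqF//; lra.
have -> // : (1 - b / (p - 1)) * (p - 1) = p - 1 - b.
by field; rewrite gt_eqF.
Qed.
End weighted_hoelder.

(** * Exchange of integrals over the triangle [0 < r < s < 1] *)

Section triangle_fubini.
Context {R : realType}.
Local Notation mu := (@lebesgue_measure R).
Variables (e : R) (k : R -> R).
Hypothesis mk : measurable_fun (`]0, 1[%classic : set R) k.
Hypothesis k0 : forall s, 0 <= k s.

Let A : set (R * R) := [set z | [&& 0 < z.1, z.1 < z.2 & z.2 < 1]].

(** The restriction of [k] makes the integrand measurable on the plane, since [k] is only measurable
    on []0, 1[]; the indicator cuts out the triangle. *)
Let F (z : R * R) : \bar R := ((z.1 `^ e * (k \_ `]0, 1[) z.2) * \1_A z)%:E.

Let FE r s : F (r, s) = if [&& 0 < r, r < s & s < 1] then (r `^ e * k s)%:E else 0%E.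
Proof.
rewrite /F indicE; case: ifPn => [rs|nrs].
  rewrite mem_set// mulr1 patchE mem_set//= in_itv/=.
  by move: rs => /and3P[r0 rs ->]; rewrite (lt_trans r0).
by rewrite memNset ?mulr0//; exact/negP.
Qed.

Let mF : measurable_fun setT F.
Proof.
apply/measurable_EFinP; apply: measurable_funM.
  apply: measurable_funM.
    by apply: measurableT_comp (measurable_powR e) measurable_fst.
  apply: measurableT_comp measurable_snd.
  by apply/(measurable_restrictT k (measurable_itv _)).
apply: measurable_indic.
have -> : A = (fst @^-1` `]0, +oo[) `&` (snd @^-1` `]-oo, 1[) `&`
    ((fun z : R * R => z.2 - z.1) @^-1` `]0, +oo[).
  apply/seteqP; split => [z /= /and3P[z1 z12 z2]|z /= []].
    by rewrite !in_itv/= !andbT subr_gt0.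
  by rewrite !in_itv/= !andbT subr_gt0 => -[z1 z2 z12]; apply/and3P.
apply: measurableI; first apply: measurableI.
- by rewrite -[X in measurable X]setTI; apply: measurable_fst.
- by rewrite -[X in measurable X]setTI; apply: measurable_snd.
- rewrite -[X in measurable X]setTI.
  by apply: (measurable_funB measurable_snd measurable_fst).
Qed.

Let F0 z : (0 <= F z)%E.
Proof.
case: z => r s; rewrite FE; case: ifP => // _.
by rewrite lee_fin mulr_ge0 ?powR_ge0.
Qed.

Let J r := (\int[mu]_(s in `]r, 1%R[) (k s)%:E)%E.

Let intF1 r : (\int[mu]_s F (r, s))%E = ((fun r => (r `^ e)%:E * J r)%E \_ `]0, 1[) r.
Proof.
rewrite patchE; case: ifPn => [|r01].
  rewrite inE/= in_itv/= => /andP[r0 r1]; rewrite /J -ge0_integralZl//=; last 3 first.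
  - apply/measurable_EFinP; apply: measurable_funS mk => //.
    by move=> s /=; rewrite !in_itv/= => /andP[rs ->]; rewrite (lt_trans r0).
  - by move=> s _; rewrite lee_fin.
  - by rewrite lee_fin powR_ge0.
  rewrite [RHS]integral_mkcond; apply: eq_integral => s _.
  by rewrite FE patchE mem_setE in_itv/= r0; case: ifP.
rewrite integral0_eq// => s _; rewrite FE; case: ifPn => // /and3P[r0 rs s1].
move: r01; rewrite notin_setE/= in_itv/= r0 => /negP.
by rewrite (lt_trans rs s1).
Qed.

Let intF2 s : (\int[mu]_r F (r, s))%E =
  ((fun s => (k s)%:E * \int[mu]_(r in `]0%R, s[) (r `^ e)%:E)%E \_ `]0, 1[) s.
Proof.
rewrite patchE; case: ifPn => [|s01].
  rewrite inE/= in_itv/= => /andP[s0 s1]; rewrite -ge0_integralZl//=; last 3 first.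
  - apply/measurable_EFinP; exact: measurable_powRT.
  - by move=> r _; rewrite lee_fin powR_ge0.
  - by rewrite lee_fin.
  rewrite [RHS]integral_mkcond; apply: eq_integral => r _.
  by rewrite FE patchE mem_setE in_itv/= s1 andbT; case: ifP => // _; rewrite mulrC.
rewrite integral0_eq// => r _; rewrite FE; case: ifPn => // /and3P[r0 rs s1].
move: s01; rewrite notin_setE/= in_itv/= s1 => /negP.
by rewrite (lt_trans r0 rs).
Qed.

(** The function is a partial integral of the nonnegative measurable [F], and Tonelli's theorem
    gives the measurability of such integrals. *)
Lemma measurable_integral_itv :
  measurable_fun (`]0, 1[%classic : set R)
    (fun r => ((r `^ e)%:E * \int[mu]_(s in `]r, 1%R[) (k s)%:E)%E).
Proof.
apply/(measurable_restrictT _ (measurable_itv _)).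
have := @measurable_fun_fubini_tonelli_F _ _ (measurableTypeR R) (measurableTypeR R) R mu F mF F0.
by congr measurable_fun; apply/funext => r; exact: intF1.
Qed.

Lemma measurable_integral_itv0 :
  measurable_fun (`]0, 1[%classic : set R)
    (fun s => ((k s)%:E * \int[mu]_(r in `]0%R, s[) (r `^ e)%:E)%E).
Proof.
apply/(measurable_restrictT _ (measurable_itv _)).
have := @measurable_fun_fubini_tonelli_G _ _ (measurableTypeR R) (measurableTypeR R) R mu F mF F0.
by congr measurable_fun; apply/funext => s; exact: intF2.
Qed.

Lemma fubini_triangle :
  (\int[mu]_(r in `]0%R, 1%R[) ((r `^ e)%:E * \int[mu]_(s in `]r, 1%R[) (k s)%:E) =
   \int[mu]_(s in `]0%R, 1%R[) ((k s)%:E * \int[mu]_(r in `]0%R, s[) (r `^ e)%:E))%E.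
Proof.
rewrite [LHS]integral_mkcond [RHS]integral_mkcond.
under eq_integral do rewrite -intF1.
under [RHS]eq_integral do rewrite -intF2.
exact: (@fubini_tonelli _ _ (measurableTypeR R) (measurableTypeR R) R mu mu F mF F0).
Qed.
End triangle_fubini.

(** * The logarithmic modular *)

Section log_factor.
Context {R : realType}.

Lemma log_factor_le (tau beta kappa c r v : R) : 1 <= tau -> 0 < beta ->
  0 <= kappa -> 0 <= c -> 0 < r -> r < 1 -> 0 <= v -> v <= c * r `^ (- kappa) ->
  `|ln (tau + v)| `^ (r `^ beta) <= expR (1 + ln (tau + c) + kappa / beta).
Proof.
move=> tau1 beta0 kappa0 c0 r0 r1 v0 vc.
have rk1 : 1 <= r `^ (- kappa).
  by rewrite -[leLHS](powRr0 r); apply: ger_powR; [rewrite r0 ltW|lra].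
have l0 : 0 <= ln (tau + v) by rewrite ln_ge0//; lra.
have lr0 : ln r <= 0 by rewrite ln_le0// ltW.
have lnle : ln (tau + v) <= ln (tau + c) - kappa * ln r.
  have -> : ln (tau + c) - kappa * ln r = ln ((tau + c) * r `^ (- kappa)).
    by rewrite lnM ?posrE ?powR_gt0 ?ln_powR ?mulNr//; lra.
  rewrite ler_ln ?posrE ?mulr_gt0 ?powR_gt0//; [|lra|lra].
  by rewrite mulrDl lerD// ler_peMr//; lra.
have lc0 : 0 <= ln (tau + c) by rewrite ln_ge0//; lra.
set y := 1 + ln (tau + c) - kappa * ln r.
have kr0 : kappa * ln r <= 0 by rewrite mulr_ge0_le0.
have y1 : 1 <= y by rewrite /y; lra.
have rb0 : 0 < r `^ beta by rewrite powR_gt0.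
have rb1 : r `^ beta <= 1 by rewrite -(powRr0 r); apply: ger_powR; rewrite ?r0 ?ltW.
apply: (@le_trans _ _ (y `^ (r `^ beta))).
  rewrite ger0_norm// ge0_ler_powR ?nnegrE//; rewrite /y; lra.
rewrite /powR gt_eqF; last lra.
rewrite ler_expR.
have lny : ln y <= y by apply/ltW/ln_sublinear; lra.
apply: (@le_trans _ _ (r `^ beta * y)); first by apply: ler_wpM2l => //; exact: ltW.
have brl : - (r `^ beta * ln r) <= beta^-1.
  have : ln (r `^ (- beta)) <= r `^ (- beta).
    by apply/ltW/ln_sublinear/powR_gt0.
  rewrite ln_powR powRN mulNr => h.
  rewrite -[leRHS]mul1r ler_pdivlMr// mulNr -mulrA (mulrC _ beta).
  rewrite -mulrN -ler_pdivlMl// mulr1; lra.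
rewrite /y mulrDr mulrDr mulr1; apply: lerD.
  by apply: lerD => //; rewrite ler_piMl.
by rewrite mulrN mulrCA -mulrN; apply: ler_wpM2l.
Qed.

End log_factor.

(** * Pointwise bound and Hardy's inequality with power weights *)

Section weighted_hardy_sobolev.
Context {R : realType}.
Local Notation mu := (@lebesgue_measure R).
Implicit Types (u g : R -> R).

Lemma measurable_powR_normM (D : set R) g (p e : R) : measurable D ->
  measurable_fun D g -> measurable_fun D (fun s => `|g s| `^ p * s `^ e).
Proof.
move=> mD mg; apply: measurable_funM; last exact: measurable_powRT.
by apply: (measurableT_comp (measurable_powR p)); apply: measurableT_comp.
Qed.

Lemma measurable_powRM_norm (D : set R) g (p e : R) : measurable D ->
  measurable_fun D g -> measurable_fun D (fun s => s `^ e * `|g s| `^ p).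
Proof.
move=> mD mg; apply: measurable_funM; first exact: measurable_powRT.
by apply: (measurableT_comp (measurable_powR p)); apply: measurableT_comp.
Qed.

Definition weighted_hoelder_constant (p b : R) : R := ((p - 1) / (b - p + 1)) `^ (p - 1).

Lemma weighted_hoelder_constant_gt0 (p b : R) : 1 < p -> p - 1 < b ->
  0 < weighted_hoelder_constant p b.
Proof. by move=> p1 pb; rewrite powR_gt0// divr_gt0//; lra. Qed.

Lemma integral_itv_le_weighted_norm g (p b alpha r : R) : 1 < p -> p - 1 < b -> b <= alpha ->
  measurable_fun (`]0, 1[%classic : set R) g -> 0 < r -> r < 1 ->
  ((\int[mu]_(s in `]r, 1%R[) `|g s|%:E) `^ p <=
   (weighted_hoelder_constant p b * r `^ (p - 1 - alpha))%:E *
   \int[mu]_(s in `]0%R, 1%R[) (s `^ alpha * `|g s| `^ p)%:E)%E.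
Proof.
move=> p1 pb ba mg r0 r1.
apply: (le_trans (integral_itv_weighted_hoelder _ _ _ _ p1 pb mg r0 r1)).
rewrite -/(weighted_hoelder_constant p b) !EFinM -!muleA.
apply: lee_wpmul2l; first by rewrite lee_fin powR_ge0.
have D01 : `]r, 1[ `<=` (`]0, 1[ : set R).
  by move=> s /=; rewrite !in_itv/= => /andP[rs ->]; rewrite (lt_trans r0).
have mgr : measurable_fun `]r, 1[ g by exact: measurable_funS mg.
rewrite -ge0_integralZl//=; last 3 first.
- by apply/measurable_EFinP; exact: measurable_powR_normM.
- by move=> s _; rewrite lee_fin mulr_ge0// powR_ge0.
- by rewrite lee_fin powR_ge0.
apply: (@le_trans _ _ (\int[mu]_(s in `]r, 1%R[)
    ((r `^ (p - 1 - alpha))%:E * (s `^ alpha * `|g s| `^ p)%:E))%E).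
  apply: ge0_le_integral => //.
  - by move=> s _; rewrite mule_ge0// lee_fin ?mulr_ge0 ?powR_ge0.
  - apply: measurable_funeM.
    by apply/measurable_EFinP; exact: measurable_powR_normM.
  - by apply: measurable_funeM; apply/measurable_EFinP; exact: measurable_powRM_norm.
  - move=> s /=; rewrite in_itv/= => /andP[rs s1]; have s0 := lt_trans r0 rs.
    rewrite -!EFinM lee_fin (mulrC (`|g s| `^ p)) !mulrA; apply: ler_wpM2r; first exact: powR_ge0.
    have -> : r `^ (p - 1 - b) = r `^ (p - 1 - alpha) * r `^ (alpha - b).
      by rewrite -powRD; [congr (_ `^ _); lra|apply/implyP => _; rewrite gt_eqF].
    have -> : s `^ alpha = s `^ (alpha - b) * s `^ b.
      by rewrite -powRD; [congr (_ `^ _); lra|apply/implyP => _; rewrite gt_eqF].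
    rewrite -!mulrA; apply: ler_wpM2l; first exact: powR_ge0.
    apply: ler_wpM2r; first exact: powR_ge0.
    by apply: ge0_ler_powR; rewrite ?nnegrE ?subr_ge0// ltW.
rewrite ge0_integralZl//=; last 3 first.
- by apply/measurable_EFinP; exact: measurable_powRM_norm.
- by move=> s _; rewrite lee_fin mulr_ge0// powR_ge0.
- by rewrite lee_fin powR_ge0.
apply: lee_wpmul2l; first by rewrite lee_fin powR_ge0.
apply: ge0_subset_integral => //.
  by apply/measurable_EFinP; exact: measurable_powRM_norm.
by move=> s _; rewrite lee_fin mulr_ge0// powR_ge0.
Qed.

(** Exchanging the integrals leaves the integral of [r]^ (alpha - 1 - b)[over]]0,
    s[[, which is finite because]b <
    alpha[. Combined with]integral_itv_weighted_hoelder[this is Hardy's inequality, as]r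
    [^ (alpha - p) * r]^ (p - 1 - b) = r [^ (alpha - 1 - b)]. *)
Lemma weighted_hardy g (p b alpha : R) : 1 < p -> p - 1 < b -> b < alpha ->
  measurable_fun (`]0, 1[%classic : set R) g ->
  (\int[mu]_(r in `]0%R, 1%R[) ((r `^ (alpha - 1 - b))%:E *
      \int[mu]_(s in `]r, 1%R[) (`|g s| `^ p * s `^ b)%:E) <=
   (alpha - b)^-1%:E * \int[mu]_(s in `]0%R, 1%R[) (s `^ alpha * `|g s| `^ p)%:E)%E.
Proof.
move=> p1 pb ba mg.
rewrite fubini_triangle; [|exact: measurable_powR_normM|by move=> s; rewrite mulr_ge0// powR_ge0].
rewrite -ge0_integralZl//=; last 3 first.
- by apply/measurable_EFinP; exact: measurable_powRM_norm.
- by move=> s _; rewrite lee_fin mulr_ge0// powR_ge0.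
- by rewrite lee_fin invr_ge0; lra.
apply: ge0_le_integral => //.
- move=> s _; apply: mule_ge0; first by rewrite lee_fin mulr_ge0// powR_ge0.
  by apply: integral_ge0 => r _; rewrite lee_fin powR_ge0.
- apply: measurable_integral_itv0; first exact: measurable_powR_normM.
  by move=> s; rewrite mulr_ge0// powR_ge0.
- apply: measurable_funeM.
  by apply/measurable_EFinP; exact: measurable_powRM_norm.
- move=> s /=; rewrite in_itv/= => /andP[s0 s1].
  have ab0 : 0 < alpha - b by rewrite subr_gt0.
  apply: (@le_trans _ _ ((`|g s| `^ p * s `^ b)%:E * (s `^ (alpha - b) / (alpha - b))%:E)%E).
    apply: lee_wpmul2l; first by rewrite lee_fin mulr_ge0// powR_ge0.
    by rewrite addrAC; exact: integral_powR_le.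
  rewrite -!EFinM lee_fin le_eqVlt; apply/orP; left; apply/eqP.
  have -> : s `^ alpha = s `^ b * s `^ (alpha - b).
    by rewrite -powRD; [congr (_ `^ _); lra|apply/implyP => _; rewrite gt_eqF].
  by field; rewrite gt_eqF.
Qed.
End weighted_hardy_sobolev.

(** * Bound of the modular by the gradient norm *)

Section log_modular_estimate.
Context {R : realType}.
Local Notation mu := (@lebesgue_measure R).
Implicit Types (u g : R -> R).

Lemma measurable_fun_powR2 (D : set R) (f h : R -> R) : measurable D ->
  measurable_fun D f -> measurable_fun D h -> measurable_fun D (fun x => f x `^ h x).
Proof.
move=> mD mf mh.
have mS (A : set R) (k : R -> R) : measurable_fun D k -> measurable (D `&` A) ->
    measurable_fun (D `&` A) k.
  by move=> mk mDA; apply: measurable_funS mk => //; exact: subIsetl.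
have eq0 (k : R -> R) : measurable_fun D k -> measurable_fun D (fun x => k x == 0).
  by move=> mk; apply: measurable_fun_eqr.
have mA (k : R -> R) b : measurable_fun D k -> measurable (D `&` (fun x => k x == 0) @^-1` [set b]).
  by move=> mk; apply: eq0.
rewrite /powR; apply: measurable_fun_if => //; first exact: eq0.
- apply: mS; last exact: mA.
  have -> : (fun x => (h x == 0)%:R : R) = (fun x => if h x == 0 then 1 else 0).
    by apply/funext => x; case: ifP.
  by apply: measurable_fun_if => //; exact: eq0.
- apply: mS; last exact: mA.
  apply: measurableT_comp => //; apply: measurable_funM => //.
  by apply: measurableT_comp => //; exact: measurable_ln.
Qed.

(** The factors come from the pointwise bound raised to the power [s - p], from Hoelder's
    inequality, and from Hardy's inequality. *)
Definition hardy_sobolev_constant (p b alpha s : R) : R :=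
  (weighted_hoelder_constant p b `^ p^-1) `^ (s - p) *
    weighted_hoelder_constant p b / (alpha - b).

Lemma measurable_log_modular (theta s tau beta : R) u :
  measurable_fun (`]0, 1[%classic : set R) u ->
  measurable_fun (`]0, 1[%classic : set R) (fun r =>
    (r `^ theta * `|u r| `^ s * `|ln (tau + `|u r|)| `^ (r `^ beta))%:E).
Proof.
move=> m_u; apply/measurable_EFinP; apply: measurable_funM.
  exact: measurable_powRM_norm.
apply: measurable_fun_powR2 => //; last exact: measurable_powRT.
apply: measurableT_comp => //; apply: measurableT_comp; first exact: measurable_ln.
by apply: measurable_funD => //; exact: measurableT_comp.
Qed.

(** The bound is explicit in [M] because the norm estimate needs it to become small with [M]. The
    function [g] enters only through the almost everywhere domination, a relation preserved by
    scaling. *)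
Lemma log_modular_le (p b alpha theta tau beta M s : R) u g :
  1 < p -> p - 1 < b -> b < alpha -> alpha - p < theta -> 1 <= tau -> 0 < beta ->
  0 < M ->
  measurable_fun (`]0, 1[%classic : set R) u ->
  measurable_fun (`]0, 1[%classic : set R) g ->
  (\int[mu]_(s in `]0%R, 1%R[) (s `^ alpha * `|g s| `^ p)%:E <= (M `^ p)%:E)%E ->
  {ae mu, forall r, r \in `]0, 1[ ->
    (`|u r|%:E <= \int[mu]_(s in `]r, 1%R[) `|g s|%:E)%E} ->
  s = critical_exponent p alpha theta ->
  (log_modular theta s tau beta u <=
   (expR (1 + ln (tau + weighted_hoelder_constant p b `^ p^-1 * M)
            + (alpha - p + 1) / p / beta)
    * hardy_sobolev_constant p b alpha s * M `^ s)%:E)%E.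
Proof.
move=> p1 pb ba athe tau1 beta0 M0 m_u mg gM ug sE.
set c1 := weighted_hoelder_constant p b.
have c10 : 0 < c1 by exact: weighted_hoelder_constant_gt0.
set c2 := c1 `^ p^-1; set K := expR _; set kappa := (alpha - p + 1) / p.
have c20 : 0 < c2 by exact: powR_gt0.
have p0 : 0 < p by lra.
have app : 0 < alpha - p + 1 by lra.
have kappa0 : 0 < kappa by rewrite divr_gt0.
(* [kappa] is the decay exponent of the pointwise bound. From its products with [s] and [p], the
   assumption [alpha - p < theta] is the same as [p < s]. *)
have kappas : kappa * s = theta + 1.
  by rewrite /kappa sE /critical_exponent; field; rewrite !gt_eqF.
have kappap : kappa * p = alpha - p + 1 by rewrite divfK// gt_eqF.
have sp : p < s by rewrite -(ltr_pM2l kappa0) kappas kappap; lra.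
pose Q := K * (c2 * M) `^ (s - p) * c1.
have Q0 : 0 <= Q by rewrite !mulr_ge0 ?powR_ge0 ?expR_ge0// ltW.
pose J r := (\int[mu]_(s in `]r, 1%R[) (`|g s| `^ p * s `^ b)%:E)%E.
have J0 r : (0 <= J r)%E.
  by apply: integral_ge0 => t _; rewrite lee_fin mulr_ge0// powR_ge0.
have mJ : measurable_fun (`]0, 1[%classic : set R) (fun r => ((r `^ (alpha - 1 - b))%:E * J r)%E).
  apply: measurable_integral_itv; first exact: measurable_powR_normM.
  by move=> t; rewrite mulr_ge0// powR_ge0.
have rJ0 r : (0 <= (r `^ (alpha - 1 - b))%:E * J r)%E.
  by rewrite mule_ge0// lee_fin powR_ge0.
apply: (@le_trans _ _ (\int[mu]_(r in `]0%R, 1%R[) (Q%:E * ((r `^ (alpha - 1 - b))%:E * J r)))%E).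
  apply: ae_ge0_le_integral => //.
  - by move=> r _; rewrite lee_fin !mulr_ge0// powR_ge0.
  - exact: measurable_log_modular.
  - by move=> r _; rewrite mule_ge0.
  - exact: measurable_funeM.
  - move: ug; apply: filterS; first exact: (ae_filter_ringOfSetsType mu).
    move=> r /= ur r01; move: (r01) => /= /[dup] /ur {}ur.
    rewrite in_itv/= => /andP[r0 r1].
    have up : ((`|u r| `^ p)%:E <= (\int[mu]_(s in `]r, 1%R[) `|g s|%:E) `^ p)%E.
      by rewrite -poweR_EFin; apply: ge0_lee_poweR => //; rewrite ?lee_fin// ltW.
    (* Two bounds of the same power: [uM] gives the pointwise decay [ule], used for the logarithm
       and for the surplus power [s - p]; [uJ] keeps the inner integral, as Hardy's inequality
       requires. *)
    have uM : `|u r| `^ p <= c1 * r `^ (p - 1 - alpha) * M `^ p.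
      rewrite -lee_fin (le_trans up)//.
      apply: (le_trans (integral_itv_le_weighted_norm _ _ _ _ _ p1 pb (ltW ba) mg r0 r1)).
      rewrite [leRHS]EFinM; apply: lee_wpmul2l => //.
      by rewrite lee_fin mulr_ge0 ?powR_ge0.
    have uJ : ((`|u r| `^ p)%:E <= (c1 * r `^ (p - 1 - b))%:E * J r)%E.
      exact: (le_trans up (integral_itv_weighted_hoelder _ _ _ _ p1 pb mg r0 r1)).
    have ule : `|u r| <= c2 * M * r `^ (- kappa).
      have -> : `|u r| = (`|u r| `^ p) `^ p^-1 by rewrite -powRrM divff ?gt_eqF// powRr1.
      have -> : c2 * M * r `^ (- kappa) = (c1 * r `^ (p - 1 - alpha) * M `^ p) `^ p^-1.
        rewrite !powRM ?mulr_ge0 ?powR_ge0 ?(ltW c10)// -(powRrM r) -(powRrM M) divff ?gt_eqF//.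
        have -> : - kappa = (p - 1 - alpha) / p by rewrite /kappa; field; rewrite gt_eqF.
        by rewrite (powRr1 (ltW M0)) mulrAC.
      apply: ge0_ler_powR; rewrite ?nnegrE ?invr_ge0 ?powR_ge0 ?(ltW p0)//.
      by rewrite !mulr_ge0 ?powR_ge0// ltW.
    have Lle := log_factor_le _ _ _ _ _ _ tau1 beta0 (ltW kappa0) (ltW (mulr_gt0 c20 M0))
      r0 r1 (normr_ge0 (u r)) ule.
    have usp : `|u r| `^ s <= (c2 * M) `^ (s - p) * r `^ (- kappa * (s - p)) * `|u r| `^ p.
      have -> : `|u r| `^ s = `|u r| `^ (s - p) * `|u r| `^ p.
        by rewrite -powRD ?subrK//; apply/implyP; rewrite gt_eqF//; lra.
      apply: ler_wpM2r; first exact: powR_ge0.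
      rewrite powRrM -powRM ?powR_ge0 ?mulr_ge0 ?(ltW c20) ?(ltW M0)//.
      apply: ge0_ler_powR; rewrite ?nnegrE ?subr_ge0 ?(ltW sp)//.
      by rewrite !mulr_ge0 ?powR_ge0// ltW.
    apply: (@le_trans _ _ ((K * (c2 * M) `^ (s - p) * r `^ (alpha - p))%:E * (`|u r| `^ p)%:E)%E).
      rewrite -EFinM lee_fin.
      (* The exponents match because [theta - kappa * (s - p) = theta - (theta + 1) + (alpha - p +
         1)]. *)
      have -> : r `^ (alpha - p) = r `^ theta * r `^ (- kappa * (s - p)).
        rewrite -powRD; last by apply/implyP => _; rewrite gt_eqF.
        by congr (_ `^ _); rewrite mulNr mulrBr kappas kappap; lra.
      rewrite (_ : K * _ * _ * _ = r `^ theta *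
        ((c2 * M) `^ (s - p) * r `^ (- kappa * (s - p)) * `|u r| `^ p) * K); last by ring.
      apply: ler_pM => //; first by rewrite mulr_ge0 ?powR_ge0.
      by apply: ler_wpM2l => //; exact: powR_ge0.
    apply: (@le_trans _ _ ((K * (c2 * M) `^ (s - p) * r `^ (alpha - p))%:E *
        ((c1 * r `^ (p - 1 - b))%:E * J r))%E).
      apply: lee_wpmul2l => //.
      by rewrite lee_fin !mulr_ge0 ?powR_ge0 ?expR_ge0.
    rewrite !muleA -!EFinM; apply: lee_wpmul2r => //.
    rewrite lee_fin le_eqVlt; apply/orP; left; apply/eqP.
    have -> : r `^ (alpha - 1 - b) = r `^ (alpha - p) * r `^ (p - 1 - b).
      by rewrite -powRD; [congr (_ `^ _); lra|apply/implyP => _; rewrite gt_eqF].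
    by rewrite /Q; ring.
rewrite ge0_integralZl//.
apply: (@le_trans _ _ (Q%:E * ((alpha - b)^-1%:E * (M `^ p)%:E))%E).
  apply: lee_wpmul2l; first by rewrite lee_fin.
  apply: (le_trans (weighted_hardy _ _ _ _ p1 pb ba mg)).
  by apply: lee_wpmul2l => //; rewrite lee_fin invr_ge0; lra.
rewrite -!EFinM lee_fin le_eqVlt; apply/orP; left; apply/eqP.
have -> : M `^ s = M `^ (s - p) * M `^ p.
  by rewrite -powRD ?subrK//; apply/implyP => _; rewrite gt_eqF.
rewrite /Q /hardy_sobolev_constant -/c1 -/c2 powRM ?ltW//.
ring.
Qed.
End log_modular_estimate.

(** * Functions of the weighted Sobolev space *)

Section sobolev_space.
Context {R : realType}.
Local Notation mu := (@lebesgue_measure R).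
Implicit Types (u w du : R -> R).

(** The increment of [w] on [[r, y]] is at most the integral of its absolute derivative, and [w y]
    tends to 0 as [y] tends to 1. *)
Lemma X1p_generator_le_integral_derive1 (p alpha0 alpha1 : R) w (r : R) :
  X1p_generator p alpha0 alpha1 w -> 0 < r -> r < 1 ->
  (`|w r|%:E <= \int[mu]_(s in `]r, 1%R[) `|derive1 w s|%:E)%E.
Proof.
move=> [acw w1 _ [mw' _]] r0 r1.
have mr : measurable_fun `]r, 1[ (derive1 w).
  apply: measurable_funS mw' => //.
  by move=> s /=; rewrite !in_itv/= => /andP[rs ->]; rewrite (lt_trans r0).
have Iy y : r < y -> y < 1 ->
    (`|w y - w r|%:E <= \int[mu]_(s in `]r, 1%R[) `|derive1 w s|%:E)%E.
  move=> ry y1.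
  have ry1 : `]r, y[ `<=` (`]r, 1[ : set R).
    by move=> s /=; rewrite !in_itv/= => /andP[-> /lt_trans ->].
  have mry : measurable_fun `]r, y[ (derive1 w) by exact: measurable_funS mr.
  apply: le_trans
    (abs_continuous_le_integral_derive1 _ _ _ (ltW ry) (acw _ _ r0 (ltW ry) y1) mry) _.
  apply: ge0_subset_integral => //.
  by apply/measurable_EFinP; exact: measurableT_comp.
apply/lee_addgt0Pr => e e0.
near (1 : R)^'- => y.
have ry : r < y by near: y; exact: nbhs_left_gt.
have y1 : y < 1 by [].
have wy : `|w y| <= e.
  near: y; move/cvgrPdist_le : w1 => /(_ _ e0); apply: filterS => y.
  by rewrite sub0r normrN.
apply: le_trans (leeD2r e%:E (Iy _ ry y1)).
rewrite -EFinD lee_fin -lerBlDr.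
rewrite distrC (le_trans _ (lerB_dist _ _))//; lra.
Unshelve. all: by end_near. Qed.

Lemma sobolev_norm_lt (p alpha0 alpha1 e : R) u du : 1 < p ->
  (sobolev_norm p alpha0 alpha1 u du < e%:E)%E ->
  (\int[mu]_(r in `]0%R, 1%R[) (r `^ alpha0 * `|u r| `^ p)%:E <= (e `^ p)%:E)%E /\
  (\int[mu]_(r in `]0%R, 1%R[) (r `^ alpha1 * `|du r| `^ p)%:E <= (e `^ p)%:E)%E.
Proof.
move=> p1; have p0 : 0 < p by lra.
suff H (x y : \bar R) : (0 <= x)%E -> (0 <= y)%E ->
    ((((x `^ p^-1) `^ p + (y `^ p^-1) `^ p) `^ p^-1) < e%:E)%E ->
    (x <= (e `^ p)%:E)%E /\ (y <= (e `^ p)%:E)%E.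
  by move=> h; apply: H h; apply: integral_ge0 => s _; rewrite lee_fin mulr_ge0// powR_ge0.
move=> x0 y0; have pN0 : p != 0 by rewrite gt_eqF.
have rootK (z : \bar R) : (0 <= z)%E -> ((z `^ p^-1) `^ p)%E = z.
  by move=> z0; rewrite -poweRrM mulVf// poweRe1.
rewrite (rootK _ x0) (rootK _ y0) => /ltW h.
have : (x + y <= (e `^ p)%:E)%E.
  rewrite -poweR_EFin -(rootK (x + y)%E) ?adde_ge0//.
  by apply: ge0_lee_poweR => //; rewrite ?poweR_ge0// ltW.
move=> xy; split; apply: le_trans xy; [exact: leeDl|exact: leeDr].
Qed.

End sobolev_space.

(** * Passage from the generators to their closure *)

Section sobolev_closure.
Context {R : realType}.
Local Notation mu := (@lebesgue_measure R).
Implicit Types (u w du : R -> R).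

(** The infimum over the tail from [m] on lies below every [f n] with [m <= n], so its integral is 0
    and it vanishes almost everywhere, for all [m] at once. Arbitrarily late indices with small
    values replace the extraction of a subsequence. *)
Lemma ae_liminf_eq0 (D : set R) (f : nat -> R -> \bar R) : measurable D ->
  (forall n, measurable_fun D (f n)) -> (forall n x, D x -> (0 <= f n x)%E) ->
  (forall n, (\int[mu]_(x in D) f n x <= n.+1%:R^-1%:E)%E) ->
  {ae mu, forall x, D x -> forall (m : nat) (e : R), 0 < e ->
    exists2 n, (m <= n)%N & (f n x < e%:E)%E}.
Proof.
move=> mD mf f0 intf.
have meinfs := measurable_fun_einfs mf.
have einfs_ge0 m x : D x -> (0 <= einfs (f ^~ x) m)%E.
  by move=> Dx; apply: le_ereal_inf_tmp => _ [n _ <-]; exact: f0.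
have ae0 m : {ae mu, forall x, D x -> einfs (f ^~ x) m = 0%E}.
  have [+ _] := @ae_eq_integral_abs _ (measurableTypeR R) R mu D mD _ (meinfs m).
  apply.
  apply/eqP; rewrite eq_le integral_ge0 ?andbT; last by [].
  apply/lee_addgt0Pr => e e0; rewrite add0e.
  pose n := maxn m (Num.truncn e^-1).
  apply: (@le_trans _ _ (\int[mu]_(x in D) f n x)%E).
    apply: ge0_le_integral => //.
    - by apply: measurableT_comp => //; exact: meinfs.
    - exact: mf.
    - move=> x Dx; rewrite gee0_abs; last exact: einfs_ge0.
      by apply: ereal_inf_lbound; exists n => //=; exact: leq_maxl.
  apply: (le_trans (intf n)); rewrite lee_fin -[leRHS]invrK lef_pV2 ?posrE ?invr_gt0//.
  apply/ltW/(lt_le_trans (truncnS_gt _)).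
  by rewrite ler_nat ltnS leq_maxr.
have := ae_foralln ae0; apply: filterS => x fx0 Dx m e e0.
have : (einfs (f ^~ x) m < e%:E)%E by rewrite fx0// lte_fin.
by move=> /ereal_inf_lt[_ [n /= mn <-]] fne; exists n.
Qed.

(** At almost every [r] some late generator [w n] is close to [u], and its bound by the integral of
    its derivative differs from that of [du] by at most the approximation error times a constant
    depending on [r]. *)
Lemma X1p_ae_le_integral (p alpha0 alpha1 : R) u du : 1 < p ->
  0 < alpha1 - p + 1 -> X1p p alpha0 alpha1 u du ->
  {ae mu, forall r, r \in `]0, 1[ ->
    (`|u r|%:E <= \int[mu]_(s in `]r, 1%R[) `|du s|%:E)%E}.
Proof.
move=> p1 app [[m_u _] [mdu _] _ uw].
have p0 : 0 < p by lra.
have pb : p - 1 < alpha1 by lra.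
have e0 n : 0 < n.+1%:R^-1 :> R by rewrite invr_gt0.
have /choice[w wP] : forall n : nat, exists w, X1p_generator p alpha0 alpha1 w /\
    (sobolev_norm p alpha0 alpha1 (u \- w)%R (du \- derive1 w)%R < n.+1%:R^-1%:E)%E.
  by move=> n; have [w] := uw _ (e0 n); exists w.
have mw n : measurable_fun (`]0, 1[%classic : set R) (w n) by have [[_ _ []]] := wP n.
have mw' n : measurable_fun (`]0, 1[%classic : set R) (derive1 (w n)) by have [[_ _ _ []]] := wP n.
(* The errors are at most 1 and [p > 1], so their [p]-th powers obey the bound that [ae_liminf_eq0]
   asks for. *)
have e1 n : (n.+1%:R^-1 : R) `^ p <= n.+1%:R^-1.
  by apply: ge1r_powR; [rewrite e0 invf_le1// ler1n|exact: ltW].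
pose f n r := (r `^ alpha0 * `|(u \- w n) r| `^ p)%:E.
have mf n : measurable_fun (`]0, 1[%classic : set R) (f n).
  apply/measurable_EFinP; apply: measurable_powRM_norm => //.
  exact: measurable_funB.
have f0 n r : (`]0, 1[%classic : set R) r -> (0 <= f n r)%E.
  by move=> _; rewrite lee_fin mulr_ge0 ?powR_ge0.
have intf n : (\int[mu]_(r in `]0%R, 1%R[) f n r <= n.+1%:R^-1%:E)%E.
  have [_ /(sobolev_norm_lt _ _ _ _ _ _ p1)[+ _]] := wP n.
  by move=> /le_trans; apply; rewrite lee_fin.
have := ae_liminf_eq0 _ _ (measurable_itv _) mf f0 intf.
apply: filterS; first exact: (ae_filter_ringOfSetsType mu).
move=> r /= H r01; have {H} := H r01.
move: r01; rewrite in_itv/= => /andP[r0 r1] H.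
set G := (\int[mu]_(s in _) _)%E.
(* The factor by which the weighted norm controls the integral over []r, 1[], from the case
   [b = alpha1] of the weighted estimate. *)
pose k := (weighted_hoelder_constant p alpha1 * r `^ (p - 1 - alpha1)) `^ p^-1.
have k0 : 0 <= k by exact: powR_ge0.
have sub : `]r, 1[ `<=` (`]0, 1[ : set R).
  by move=> s /=; rewrite !in_itv/= => /andP[rs ->]; rewrite (lt_trans r0).
have mdur : measurable_fun `]r, 1[ du by exact: measurable_funS mdu.
have mwr n : measurable_fun `]r, 1[ (derive1 (w n)) by exact: measurable_funS (mw' n).
have wle n : (`|w n r|%:E <= G + (k * n.+1%:R^-1)%:E)%E.
  have [wg wn] := wP n.
  apply: (le_trans (X1p_generator_le_integral_derive1 _ _ _ _ _ wg r0 r1)).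
  pose D := (\int[mu]_(s in `]r, 1%R[) `|(du \- derive1 (w n)) s|%:E)%E.
  have D0 : (0 <= D)%E by apply: integral_ge0 => s _; rewrite lee_fin.
  apply: (@le_trans _ _ (G + D)%E).
    have m1 : measurable_fun `]r, 1[ (fun s => `|du s|%:E).
      by apply/measurable_EFinP; exact: measurableT_comp.
    have m2 : measurable_fun `]r, 1[ (fun s => `|(du \- derive1 (w n)) s|%:E).
      apply/measurable_EFinP; apply: (@measurableT_comp _ _ _ _ _ _ (fun x : R => `|x|)) => //.
      exact: measurable_funB.
    rewrite -ge0_integralD//=.
    apply: ge0_le_integral => //.
    - apply/measurable_EFinP; apply: (@measurableT_comp _ _ _ _ _ _ (fun x : R => `|x|)) => //.
      exact: mwr.
    - exact: emeasurable_funD.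
    - move=> s _; rewrite -EFinD lee_fin.
      rewrite -{1}(subrK (du s) (derive1 (w n) s)) addrC.
      by rewrite (le_trans (ler_normD _ _))// (distrC (du s)).
  apply: leeD2l.
  have [_ dn] := sobolev_norm_lt _ _ _ _ _ _ p1 wn.
  have mdw : measurable_fun (`]0, 1[%classic : set R) (du \- derive1 (w n)).
    exact: measurable_funB.
  have DP := integral_itv_le_weighted_norm _ _ _ _ _ p1 pb (lexx _) mdw r0 r1.
  have : (D `^ p <= ((k * n.+1%:R^-1) `^ p)%:E)%E.
    apply: (le_trans DP).
    have kp : k `^ p = weighted_hoelder_constant p alpha1 * r `^ (p - 1 - alpha1).
      by rewrite /k -powRrM mulVf ?gt_eqF// powRr1// mulr_ge0 ?powR_ge0.
    rewrite powRM ?(ltW (e0 n))// kp [leRHS]EFinM.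
    by apply: lee_wpmul2l => //; rewrite lee_fin mulr_ge0 ?powR_ge0.
  have pV0 : 0 <= p^-1 by rewrite invr_ge0 ltW.
  move=> /(ge0_lee_poweR pV0 (poweR_ge0 _ _)).
  rewrite -poweRrM mulfV ?gt_eqF// poweRe1// poweR_EFin -powRrM mulfV ?gt_eqF//.
  by rewrite powRr1// mulr_ge0// ltW.
apply/lee_addgt0Pr => e e_gt0.
have e2 : 0 < e / 2 by rewrite divr_gt0.
(* The starting index forces [k / (n + 1) <= e / 2]; the threshold carries the weight at [r], so
   that it amounts to [u] and [w n] differing by less than [e / 2]. *)
have [n mn fn] := H (Num.truncn (k / (e / 2))) (r `^ alpha0 * (e / 2) `^ p)
  (mulr_gt0 (powR_gt0 _ r0) (powR_gt0 _ e2)).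
have uwn : `|u r - w n r| < e / 2.
  move: fn; rewrite /f lte_fin ltr_pM2l ?powR_gt0// => fn.
  rewrite ltNge; apply: contraTN fn => le_e; rewrite -leNgt.
  by apply: ge0_ler_powR; rewrite ?nnegrE// ltW.
have kn : k * n.+1%:R^-1 <= e / 2.
  rewrite ler_pdivrMr// mulrC -ler_pdivrMr//.
  by apply/ltW/(lt_le_trans (truncnS_gt _)); rewrite ler_nat ltnS.
apply: (@le_trans _ _ (`|w n r|%:E + (e / 2)%:E)%E).
  rewrite -EFinD lee_fin -lerBlDl; apply: le_trans (ltW uwn); exact: lerB_dist.
apply: (@le_trans _ _ ((G + (k * n.+1%:R^-1)%:E) + (e / 2)%:E)%E).
  by apply: leeD2r.
by rewrite -addeA; apply: leeD2l; rewrite -EFinD lee_fin [leRHS]splitr lerD2r.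
Qed.
End sobolev_closure.

(** * The embedding *)

Section scaling.
Context {R : realType}.
Local Notation mu := (@lebesgue_measure R).
Implicit Types (u g : R -> R).

(** Dividing both [u] and [g] by [lambda] preserves the domination and turns the gradient bound
    [lambda * M] into [M]. *)
Lemma log_modular_div_le (p b alpha theta tau beta M s lambda : R) u g :
  1 < p -> p - 1 < b -> b < alpha -> alpha - p < theta -> 1 <= tau -> 0 < beta ->
  0 < M -> 0 < lambda ->
  measurable_fun (`]0, 1[%classic : set R) u ->
  measurable_fun (`]0, 1[%classic : set R) g ->
  (\int[mu]_(s in `]0%R, 1%R[) (s `^ alpha * `|g s| `^ p)%:E <= ((lambda * M) `^ p)%:E)%E ->
  {ae mu, forall r, r \in `]0, 1[ ->
    (`|u r|%:E <= \int[mu]_(s in `]r, 1%R[) `|g s|%:E)%E} ->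
  s = critical_exponent p alpha theta ->
  (log_modular theta s tau beta (fun r => (u r / lambda)%R) <=
   (expR (1 + ln (tau + weighted_hoelder_constant p b `^ p^-1 * M)
            + (alpha - p + 1) / p / beta)
    * hardy_sobolev_constant p b alpha s * M `^ s)%:E)%E.
Proof.
move=> p1 pb ba athe tau1 beta0 M0 l0 m_u mg gM ug sE.
have lV0 : 0 < lambda^-1 by rewrite invr_gt0.
have normV x : `|x / lambda| = lambda^-1 * `|x|.
  by rewrite normrM (gtr0_norm lV0) mulrC.
apply: (log_modular_le _ _ _ _ _ _ _ _ _ (fun r => g r / lambda)) => //.
- by apply: measurable_funM.
- by apply: measurable_funM.
- have -> : (\int[mu]_(t in `]0%R, 1%R[) (t `^ alpha * `|g t / lambda| `^ p)%:E =
      \int[mu]_(t in `]0%R, 1%R[) ((lambda^-1 `^ p)%:E * (t `^ alpha * `|g t| `^ p)%:E))%E.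
    apply: eq_integral => t _; rewrite normV powRM ?(ltW lV0)// -EFinM; congr (_%:E).
    by rewrite mulrCA.
  rewrite ge0_integralZl//; last 3 first.
  + by apply/measurable_EFinP; exact: measurable_powRM_norm.
  + by move=> t _; rewrite lee_fin mulr_ge0 ?powR_ge0.
  + by rewrite lee_fin powR_ge0.
  apply: (@le_trans _ _ ((lambda^-1 `^ p)%:E * ((lambda * M) `^ p)%:E)%E).
    by apply: lee_wpmul2l => //; rewrite lee_fin powR_ge0.
  rewrite -EFinM -powRM ?(ltW lV0) ?mulr_ge0 ?(ltW l0) ?(ltW M0)//.
  by rewrite mulKf// gt_eqF.
- move: ug; apply: filterS; first exact: (ae_filter_ringOfSetsType mu).
  move=> r /= ur r01; have {}ur := ur r01.
  move: r01; rewrite in_itv/= => /andP[r0 r1].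
  have -> : (\int[mu]_(t in `]r, 1%R[) `|g t / lambda|%:E =
      \int[mu]_(t in `]r, 1%R[) (lambda^-1%:E * `|g t|%:E))%E.
    by apply: eq_integral => t _; rewrite normV.
  rewrite ge0_integralZl//; last first.
  + by rewrite lee_fin ltW.
  + apply/measurable_EFinP; apply: measurableT_comp => //; apply: measurable_funS mg => //.
    by move=> t /=; rewrite !in_itv/= => /andP[rt ->]; rewrite (lt_trans r0).
  by rewrite normV EFinM; apply: lee_wpmul2l => //; rewrite lee_fin ltW.
Qed.
End scaling.

Theorem corollary1p2 (R : realType) (p alpha0 alpha1 theta tau beta : R)
  (hp : 1 < p) (halpha0 : 0 <= alpha0) (halpha1 : 0 <= alpha1)
  (htheta : 0 <= theta) (hsobolev : 0 < alpha1 - p + 1)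
  (halpha01 : alpha1 - p <= alpha0) (htheta1 : alpha1 - p < theta)
  (htau : 1 <= tau) (hbeta : 0 < beta) :
  let pstar := critical_exponent p alpha1 theta in
  exists2 C : R, 0 < C &
    forall u du : R -> R, X1p p alpha0 alpha1 u du ->
      L_ln theta pstar tau beta u /\
      (L_ln_norm theta pstar tau beta u <= C%:E * gradient_norm p alpha1 du)%E.
Proof.
move=> pstar.
have p0 : 0 < p by lra.
(* The midpoint of [p - 1] and [alpha1] meets both strict bounds, for Hoelder's and for Hardy's
   inequality. *)
pose b := (p - 1 + alpha1) / 2.
have pb : p - 1 < b by rewrite /b; lra.
have ba : b < alpha1 by rewrite /b; lra.
pose c2 := weighted_hoelder_constant p b `^ p^-1.
pose H := hardy_sobolev_constant p b alpha1 pstar.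
pose K M := expR (1 + ln (tau + c2 * M) + (alpha1 - p + 1) / p / beta).
have H0 : 0 <= H.
  by rewrite /H /hardy_sobolev_constant !mulr_ge0 ?powR_ge0// invr_ge0 subr_ge0 ltW.
have c20 : 0 <= c2 by exact: powR_ge0.
have pstar1 : 1 <= pstar.
  rewrite /pstar /critical_exponent ler_pdivlMr// mul1r.
  apply: (@le_trans _ _ (theta + 1)); first lra.
  by rewrite ler_peMr//; lra.
(* Chosen so that [C^-1 <= 1] and [K 1 * H * C^-1 <= 1], which makes the modular at most 1 for
   [M = C^-1]. *)
pose C := 1 + K 1 * H.
have KH0 : 0 <= K 1 * H by rewrite mulr_ge0// expR_ge0.
have C1 : 1 <= C by rewrite /C lerDl.
have C0 : 0 < C by exact: lt_le_trans C1.
exists C => // u du Xu.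
have [[m_u _] [mdu ndu] _ _] := Xu.
have aeu := X1p_ae_le_integral _ _ _ _ _ hp hsobolev Xu.
rewrite /gradient_norm.
have n0 : (0 <= weighted_norm alpha1 p du)%E by exact: poweR_ge0.
have Nfin : weighted_norm alpha1 p du \is a fin_num by rewrite ge0_fin_numE.
have IE : (\int[@lebesgue_measure R]_(r in `]0%R, 1%R[) (r `^ alpha1 * `|du r| `^ p)%:E =
    (fine (weighted_norm alpha1 p du) `^ p)%:E)%E.
  rewrite -poweR_EFin fineK// /weighted_norm -poweRrM mulVf ?gt_eqF// poweRe1//.
  by apply: integral_ge0 => r _; rewrite lee_fin mulr_ge0 ?powR_ge0.
move: Nfin n0 IE {ndu}; case: (weighted_norm alpha1 p du) => // N _.
rewrite lee_fin /= => N0 IE.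
have modular lambda M : 0 < lambda -> 0 < M -> N <= lambda * M ->
    (log_modular theta pstar tau beta (fun r => (u r / lambda)%R) <= (K M * H * M `^ pstar)%:E)%E.
  move=> l0 M0 NlM; apply: (log_modular_div_le p b alpha1 theta tau beta M pstar lambda u du) => //.
  rewrite IE lee_fin; apply: ge0_ler_powR; rewrite ?nnegrE ?(ltW p0)//.
  by rewrite mulr_ge0 ?(ltW l0) ?(ltW M0).
split.
  split; first exact: m_u.
  (* Membership is the case [lambda = 1], with [N + 1] because [M] must be positive even when
     [N = 0]. *)
  have N1 : 0 < N + 1 by lra.
  have := modular 1 (N + 1) ltr01 N1; rewrite mul1r lerDl => /(_ ler01).
  have -> : (fun r => u r / 1) = u by apply/funext => r; rewrite divr1.
  by move=> /le_lt_trans -> //; exact: ltry.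
apply/lee_addgt0Pr => e e0; rewrite -EFinM -EFinD.
(* [C * N + e] is the admissible [lambda]; the term [e] keeps it positive when [N = 0]. *)
have l0 : 0 < C * N + e by rewrite ltr_wpDl// mulr_ge0// ltW.
have CV0 : 0 < C^-1 by rewrite invr_gt0.
apply: ereal_inf_lbound; exists (C * N + e) => //; split=> //.
apply: le_trans (modular _ C^-1 l0 CV0 _) _.
  by rewrite ler_pdivlMr// mulrC lerDl ltW.
rewrite lee_fin.
(* As [C^-1 <= 1], monotonicity gives [K C^-1 <= K 1], and [1 <= pstar] gives that the power of
   [C^-1] is at most [C^-1]. *)
apply: (@le_trans _ _ (K 1 * H * C^-1)).
  apply: ler_pM; [by rewrite mulr_ge0// expR_ge0|exact: powR_ge0| |].
    apply: ler_wpM2r => //; rewrite ler_expR lerD2r lerD2l ler_ln ?posrE.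
    - by rewrite lerD2l ler_wpM2l// invf_le1.
    - by rewrite ltr_pwDl ?mulr_ge0 ?(ltW CV0)//; lra.
    - by rewrite ltr_pwDl ?mulr_ge0//; lra.
  apply: ge1r_powR => //.
  by rewrite CV0 invf_le1.
by rewrite ler_pdivrMr// mul1r /C lerDr.
Qed.
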